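(* The following two statements are equivalent. (DCC) Every cyclically $4$-edge connected cubic graph has a dominating cycle. (NWC* ) For every $4$-regular $4$-connected graph $H$ and every transition system $T$ of $H$, the graph $H$ is $T$-hamiltonian.
   Context: All graphs are finite and loopless (multiple edges are allowed). Cubic means $3$-regular. A graph $G$ is $k$-connected if $|V(G)|>k$ and $G-X$ is connected for every $X\subseteq V(G)$ with $|X|<k$. An edge cut of a connected graph $G$ is a set $E'\subseteq E(G)$ such that $G-E'$ is disconnected; it is a cyclic edge cut if at least two components of $G-E'$ are not trees. If $G$ contains two vertex-disjoint cycles, $\lambda_c(G)$ denotes the minimum size of a cyclic edge cut of $G$. A connected cubic graph $G$ is cyclically $4$-edge connected if $\lambda_c(G)\ge 4$. A dominating cycle of a graph $G$ is a cycle of $G$ which contains at least one endvertex of every edge of $G$. For a vertex $v$, $E_v$ denotes the set of edges incident with $v$. A transition system $T$ of a $4$-regular graph $H$ is a collection $T=\bigcup_{v\in V(H)}\{P_v\}$ where, for each $v$, $P_v$ is a partition of the four edges in $E_v$ into two sets of size $2$; each of these two sets is called a transition of $v$. A closed trail is a closed walk in which all edges are distinct. A trail follows a transition if the two edges of the transition are consecutive edges of the trail. $H$ is $T$-hamiltonian if it contains a $T$-trail, that is, a spanning closed trail $C$ of $H$ (one visiting every vertex) such that for each $v\in V(H)$ one of the following holds: (a) $|E(C)\cap E_v|=2$ (in this case there is no requirement that $C$ follow a transition of $v$); or (b) $C$ follows both transitions of $v$ (in this case $|E(C)\cap E_v|=4$). *)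

(* Defs.v *)
From mathcomp Require Import all_boot.

Set Implicit Arguments.
Unset Strict Implicit.
Unset Printing Implicit Defensive.

(* Edges are abstract, so parallel edges are allowed; every edge has exactly
   two ends, so loops are not. *)
Record mgraph := MGraph {
  vert : finType;
  edge : finType;
  ends : edge -> {set vert};
  card_ends : forall e, #|ends e| = 2
}.

Section Graphs.
Variable G : mgraph.

(* E_v *)
Definition edges_at (v : vert G) : {set edge G} := [set e | v \in ends e].

Definition regular (k : nat) : Prop := forall v : vert G, #|edges_at v| = k.

(* A pair (U, F) stands for the subgraph with vertex set U whose edges are the
   members of F with both ends in U.  Hence G - X is (~: X, setT) and G - E'
   is (setT, ~: E'). *)
Definition sadj (U : {set vert G}) (F : {set edge G}) : rel (vert G) :=
  [rel u v | [&& u \in U, v \in U & [exists e in F, ends e == [set u; v]]]].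

(* The null graph is not connected. *)
Definition sconnected (U : {set vert G}) (F : {set edge G}) : Prop :=
  U != set0 /\ {in U &, forall u v, connect (sadj U F) u v}.

Definition connected : Prop := sconnected setT setT.

Definition k_connected (k : nat) : Prop :=
  k < #|vert G| /\
  forall X : {set vert G}, #|X| < k -> sconnected (~: X) setT.

Definition components (U : {set vert G}) (F : {set edge G}) :
    {set {set vert G}} :=
  [set [set w in U | connect (sadj U F) v w] | v in U].

(* The closed walk v_0 e_0 v_1 e_1 ... v_(n-1) e_(n-1) v_0 is represented by
   the sequence (v_0, e_0), ..., (v_(n-1), e_(n-1)). *)
Definition closed_walk (s : seq (vert G * edge G)) : bool :=
  cycle [rel a b | ends a.2 == [set a.1; b.1]] s.

Definition walk_verts (s : seq (vert G * edge G)) : seq (vert G) :=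
  [seq d.1 | d <- s].

Definition walk_edges (s : seq (vert G * edge G)) : seq (edge G) :=
  [seq d.2 | d <- s].

Definition closed_trail (s : seq (vert G * edge G)) : bool :=
  closed_walk s && uniq (walk_edges s).

(* Two parallel edges form a cycle of length 2; since there are no loops, no
   sequence of length 1 is a closed walk. *)
Definition is_cycle (s : seq (vert G * edge G)) : bool :=
  [&& s != [::], closed_trail s & uniq (walk_verts s)].

Definition cycle_in (U : {set vert G}) (F : {set edge G})
    (s : seq (vert G * edge G)) : Prop :=
  [/\ is_cycle s, {subset walk_verts s <= U} & {subset walk_edges s <= F}].

Definition is_tree (U : {set vert G}) (F : {set edge G}) : Prop :=
  sconnected U F /\ ~ exists s, cycle_in U F s.

Definition edge_cut (A : {set edge G}) : Prop := ~ sconnected setT (~: A).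

Definition cyclic_edge_cut (A : {set edge G}) : Prop :=
  edge_cut A /\
  exists C1 C2 : {set vert G},
    [/\ C1 \in components setT (~: A), C2 \in components setT (~: A),
        C1 != C2, ~ is_tree C1 (~: A) & ~ is_tree C2 (~: A)].

Definition two_disjoint_cycles : Prop :=
  exists s1 s2, [/\ is_cycle s1, is_cycle s2 &
    forall v, v \in walk_verts s1 -> v \notin walk_verts s2].

(* [lambda_c n] means that n is the minimum size of a cyclic edge cut. *)
Definition lambda_c (n : nat) : Prop :=
  (exists2 A, cyclic_edge_cut A & #|A| = n) /\
  forall A, cyclic_edge_cut A -> n <= #|A|.

(* lambda_c is only defined for graphs with two vertex-disjoint cycles; by the
   usual convention it counts as infinite for the others (among connected
   cubic graphs: K_4, K_{3,3} and the graph with two vertices joined by three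
   edges). *)
Definition cyclically_edge_connected (k : nat) : Prop :=
  connected /\ (two_disjoint_cycles -> forall n, lambda_c n -> k <= n).

Definition dominating_cycle (s : seq (vert G * edge G)) : Prop :=
  is_cycle s /\
  forall e : edge G, exists2 v, v \in ends e & v \in walk_verts s.

(* T v is the partition P_v. *)
Definition transition_system (T : vert G -> {set {set edge G}}) : Prop :=
  forall v, partition (T v) (edges_at v) /\
    forall P : {set edge G}, P \in T v -> #|P| = 2.

(* [next s d] is the cyclic successor of d in s. *)
Definition follows (s : seq (vert G * edge G)) (P : {set edge G}) : Prop :=
  exists2 d, d \in s & P = [set d.2; (next s d).2].

Definition T_trail (T : vert G -> {set {set edge G}})
    (s : seq (vert G * edge G)) : Prop :=
  [/\ closed_trail s,
      forall v, v \in walk_verts s &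
      forall v, #|[set e in edges_at v | e \in walk_edges s]| = 2 \/
                forall P : {set edge G}, P \in T v -> follows s P].

Definition T_hamiltonian (T : vert G -> {set {set edge G}}) : Prop :=
  exists s, T_trail T s.

End Graphs.

(* Main.v *)
Require Import Defs.
From mathcomp Require Import all_boot zify.

(* Both directions rest on splitting a vertex v of a 4-regular graph H into its
   two transitions, joined by a new edge: a T-trail of H is a cycle of the
   resulting cubic graph that meets every new edge.
   If H is the line graph of a cubic graph G and the transitions at an edge uv
   are the pairs of line graph edges coming from u and from v, splitting gives
   G with every vertex replaced by a triangle, so a T-trail yields a cycle of G
   through an end of every edge; and H is 4-connected as soon as every edge cut
   of G with at least two vertices on both sides has size at least 4.
   Conversely, when H is 4-connected, the only cuts of size at most 3 in the
   split graph are those around a vertex or around a triangle avoiding the new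
   edges. These triangles are disjoint; contracting all of them gives a
   cyclically 4-edge connected cubic graph, and a dominating cycle of it can be
   rerouted through the triangles so as to meet all new edges. *)

Set Implicit Arguments.
Unset Strict Implicit.
Unset Printing Implicit Defensive.

(** * Cycles and edge cuts *)

(** A cut of the split graph consists of new edges, which stand for vertices of [H], and of edges of
    [H]. As the graph is cubic and the new edges form a perfect matching, the number of edges of [H]
    in a cut is even. A cut of size at most 3 thus has none or two of them, and replacing each by
    one of its ends yields a vertex separator of size at most 3; the free choice of these ends is
    what makes the counting succeed. A second obstacle is that cycles are sequences of darts, which
    are awkward to reroute or to contract. Both directions therefore describe the wanted cycle as a
    mere set of edges, check that all its degrees are 0 or 2 and that it is connected, and leave the
    ordering to [two_regular_cycle]. In particular the line graph is never actually split: the cycle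
    of [G] is read off the trail as the set of edges that the trail crosses from one end to the
    other. *)

Lemma connect_in (T : finType) (r : rel T) (A : {pred T}) x y :
  (forall u v, r u v -> u \in A -> v \in A) -> connect r x y -> x \in A -> y \in A.
Proof.
move=> rA /connectP[p + ->]; elim: p x => //= z p IH x /andP[rxz zp] xA.
exact: IH zp (rA _ _ rxz xA).
Qed.

(** The entries of a duplicate-free sequence form one orbit of [next s]. This serves as induction
    around a closed trail. *)
Lemma cycle_in_next (T : finType) (s : seq T) (A : {pred T}) :
    uniq s -> (forall d, d \in s -> d \in A -> next s d \in A) ->
  {in s &, forall d d', d \in A -> d' \in A}.
Proof.
move=> Us nA d d' ds d's dA.
have {}d's : fconnect (next s) d d' by rewrite (fconnect_cycle (cycle_next Us) ds).
suff /andP[] : d' \in [predI s & A] by [].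
apply: (connect_in _ d's); last by rewrite inE /= ds.
move=> u v /eqP<-; rewrite !inE /= mem_next => /andP[us uA].
by rewrite us nA.
Qed.

Section Basics.
Variable G : mgraph.
Implicit Types (u v w : vert G) (e f : edge G) (S U X : {set vert G}) (F : {set edge G}).
Implicit Types (s : seq (vert G * edge G)) (d : vert G * edge G).

Lemma ends_other e v : v \in ends e -> exists2 w, w != v & ends e = [set v; w].
Proof.
move=> ve; have /cards2P[x [y [xy E]]] : #|ends e| == 2 by rewrite card_ends.
move: ve; rewrite E !inE => /orP[]/eqP->; [exists y|exists x] => //.
  by rewrite eq_sym.
by rewrite setUC.
Qed.

Lemma endsE e : exists u v, u != v /\ ends e = [set u; v].
Proof.
have /cards2P[x [y [xy E]]] : #|ends e| == 2 by rewrite card_ends.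
by exists x, y.
Qed.

Lemma ends_neq e u v : ends e = [set u; v] -> u != v.
Proof. by move=> E; move: (card_ends e); rewrite E cards2; case: (u != v). Qed.

Lemma ends_inj e u v w : ends e = [set u; v] -> ends e = [set u; w] -> v = w.
Proof.
move=> E E'; have vu := ends_neq E.
have : v \in ends e by rewrite E !inE eqxx orbT.
by rewrite E' !inE eq_sym (negPf vu) => /eqP.
Qed.

Definition cut S := [set e | #|ends e :&: S| == 1].

Lemma cutE e u v S : ends e = [set u; v] -> (e \in cut S) = (u \in S) (+) (v \in S).
Proof.
move=> E; have uv := ends_neq E; rewrite inE E setIUl.
have I w : [set w] :&: S = if w \in S then [set w] else set0.
  case: ifP => wS; first by apply/setIidPl; rewrite sub1set.
  by apply/disjoint_setI0; rewrite disjoints1 wS.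
by rewrite !I; case: ifP => _; case: ifP => _; rewrite ?setU0 ?set0U ?cards2 ?uv ?cards1 ?cards0.
Qed.

Lemma cutC S : cut (~: S) = cut S.
Proof.
apply/setP=> e; have [u [v [_ E]]] := endsE e.
by rewrite !(cutE _ E) !inE; case: (u \in S); case: (v \in S).
Qed.

Lemma cut1 v : cut [set v] = edges_at v.
Proof.
apply/setP=> e; have [u [w [uw E]]] := endsE e.
rewrite (cutE _ E) !inE E !inE ![v == _]eq_sym.
by case: (u =P v) => [<-|] //=; rewrite eq_sym (negPf uw).
Qed.

Definition inner S := [set e | ends e \subset S].

Lemma innerE e u v S : ends e = [set u; v] -> (e \in inner S) = (u \in S) && (v \in S).
Proof. by move=> E; rewrite inE E subUset !sub1set. Qed.

(** The edge set [F] is a parameter because the count is needed for all edges, for a perfect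
    matching and for a lifted cycle. *)
Lemma handshake S F :
  \sum_(v in S) #|edges_at v :&: F| = #|inner S :&: F|.*2 + #|cut S :&: F|.
Proof.
have B (A : {set edge G}) : #|A :&: F| = \sum_(e in F) (e \in A).
  by rewrite -sum1_card -big_mkcondr; apply: eq_bigl => e; rewrite inE andbC.
under eq_bigr do rewrite B.
rewrite exchange_big /= !B -addnn -!big_split /=; apply: eq_bigr => e _.
have [u [v [uv E]]] := endsE e; rewrite (cutE _ E) (innerE _ E).
transitivity (#|ends e :&: S|).
  rewrite setIC -sum1_card -big_mkcondr; apply: eq_bigl => x.
  by rewrite !inE.
have I w : #|[set w] :&: S| = (w \in S).
  case: (boolP (w \in S)) => wS; first by rewrite (setIidPl _) ?cards1 // sub1set.
  by apply/eqP; rewrite cards_eq0; apply/eqP/disjoint_setI0; rewrite disjoints1.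
rewrite E setIUl cardsU !I (_ : _ :&: _ = set0) ?cards0.
  by case: (u \in S); case: (v \in S).
apply/setP=> x; rewrite !inE; case: eqP => // ->.
by rewrite (negPf uv) /= andbF.
Qed.

Lemma sadjTP F u v :
  reflect (exists2 e, e \in F & ends e = [set u; v]) (sadj setT F u v).
Proof.
rewrite /sadj /= !inE /=; apply: (iffP existsP) => [[e /andP[eF /eqP]]|[e eF E]].
  by exists e.
by exists e; rewrite eF E eqxx.
Qed.

Lemma sadj_sym U F : symmetric (sadj U F).
Proof. by move=> u v; rewrite /sadj /= andbCA; under eq_existsb do rewrite setUC. Qed.

Lemma connect_sadjC U F u v : connect (sadj U F) u v = connect (sadj U F) v u.
Proof. exact/sym_connect_sym/sadj_sym. Qed.

(** A walk that never turns back along the edge just used can always be continued, since each vertex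
    of [U] has a second edge in [F]; by finiteness it returns, and a shortest return is a cycle. *)
Lemma min_degree_cycle U F :
    U != set0 -> (forall e, e \in F -> ends e \subset U) ->
    (forall v, v \in U -> 1 < #|edges_at v :&: F|) ->
  exists s, cycle_in U F s.
Proof.
case/set0Pn=> v0 v0U FU deg.
pose good d := (d.1 \in ends d.2) && (d.2 \in F).
pose P d d' := [&& ends d.2 == [set d.1; d'.1], d'.2 != d.2 & good d'].
(* The default [d] never occurs at a good dart, by [nxtP] below. *)
pose nxt d := odflt d [pick d' | P d d'].
have other e w : w \in U -> exists2 f, f != e & good (w, f).
  move=> /deg; rewrite (cardsD1 e) => lt1.
  have : 0 < #|(edges_at w :&: F) :\ e| by case: (e \in _) lt1 => //= /ltnW.
  by case/card_gt0P=> f; rewrite !inE => /and3P[? ? ?]; exists f => //; apply/andP.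
have nxtP d : good d -> P d (nxt d).
  move=> /andP[dd dF]; rewrite /nxt; case: pickP => // no.
  have [w wd E] := ends_other dd.
  have wU : w \in U by apply: (subsetP (FU _ dF)); rewrite E !inE eqxx orbT.
  have [f fe gf] := other d.2 w wU.
  by move: (no (w, f)); rewrite /P E eqxx fe gf.
have itg d i : good d -> good (iter i nxt d).
  by move=> gd; elim: i => //= i /nxtP/and3P[].
have [f0 _ g0] : exists2 f, true & good (v0, f).
  have : 0 < #|edges_at v0 :&: F| by apply: ltnW; apply: deg.
  by case/card_gt0P=> f; rewrite !inE => /andP[? ?]; exists f => //; apply/andP.
(* The cycle is a walk with the shortest return time over all starting darts. *)
pose ret m := [exists d, good d && ((iter m.+1 nxt d).1 == d.1)].
have ex_ret : exists m, ret m.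
  (* One more iterate than there are darts, so two of them coincide. *)
  pose h (i : 'I_(#|{: vert G * edge G}|.+1)) := iter i nxt (v0, f0).
  have /injectivePn[i [j ij hij]] : ~~ injectiveb h.
    by apply/negP=> /injectiveP/leq_card; rewrite card_ord ltnn.
  wlog ltij : i j ij hij / i < j.
    move=> W; have [|ge] := ltnP i j; first exact: W.
    by apply: (W j i); rewrite 1?eq_sym // ltn_neqAle eq_sym ij.
  exists (j - i.+1); apply/existsP; exists (h i); rewrite itg //=.
  by rewrite -iterS subnSK // -iterD subnK ?hij // ltnW.
case: (ex_minnP ex_ret) => m /existsP[d0 /andP[gd0 /eqP cl]] min.
pose x i := iter i nxt d0.
have gx i : good (x i) by apply: itg.
have Ex i : ends (x i).2 = [set (x i).1; (x i.+1).1].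
  by have /and3P[/eqP] := nxtP _ (gx i).
have Nx i : (x i.+1).2 != (x i).2 by have /and3P[] := nxtP _ (gx i).
have ret_ge i j : i < j -> (x i).1 = (x j).1 -> m < j - i.
  move=> ij E; rewrite -(subnSK ij) ltnS; apply: min; apply/existsP; exists (x i).
  by rewrite gx subnSK // /x -iterD subnK ?(ltnW ij) //= E.
have inj_v i j : i <= m -> j <= m -> (x i).1 = (x j).1 -> i = j.
  move=> im jm E; case: (ltngtP i j) => // lt.
    by have := ret_ge _ _ lt E; lia.
  by have := ret_ge _ _ lt (esym E); lia.
(* An edge repeated at times [i < j] is traversed in opposite directions, as its starting vertices
   differ. Then the vertices at times [i.+1] and [j] agree, so [j = i.+1]: an immediate reversal,
   which [nxt] excludes. *)
have inj_e i j : i < j <= m -> (x i).2 <> (x j).2.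
  move=> /andP[ij jm] E; have := Ex i; rewrite E Ex => Es.
  have vij : (x i).1 != (x j).1 by apply/eqP => /inj_v; lia.
  have E1 : (x i).1 = (x j.+1).1.
    have : (x i).1 \in [set (x j).1; (x j.+1).1] by rewrite Es !inE eqxx.
    by rewrite !inE (negPf vij) => /eqP.
  have E2 : (x i.+1).1 = (x j).1.
    have : (x j).1 \in [set (x i).1; (x i.+1).1] by rewrite -Es !inE eqxx.
    by rewrite !inE eq_sym (negPf vij) => /eqP.
  have := ret_ge i j.+1 _ E1; have := @inj_v i.+1 j _ _ E2 => ??.
  have ji : j = i.+1 by lia.
  by have := Nx i; rewrite -ji E eqxx.
pose s := traject nxt d0 m.+1.
have nth_s (A : eqType) (p : vert G * edge G -> A) a i :
    i <= m -> nth a [seq p d | d <- s] i = p (x i).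
  by move=> im; rewrite (nth_map d0) ?size_traject ?nth_traject.
have mem_s d : d \in s -> exists2 i, i <= m & d = x i.
  by move=> /trajectP[i im ->]; exists i.
exists s; split; first last.
- by move=> e /mapP[d /mem_s[i _ ->] ->]; have /andP[] := gx i.
- move=> v /mapP[d /mem_s[i _ ->] ->]; have /andP[a b] := gx i.
  exact: subsetP (FU _ b) _ a.
apply/and3P; split=> //; first (apply/andP; split).
- rewrite /closed_walk /s /= rcons_path; apply/andP; split.
    have : fpath nxt d0 (traject nxt (nxt d0) m) by exact: fpath_traject.
    have : all good (d0 :: traject nxt (nxt d0) m).
      by apply/allP=> d /mem_s[i _ ->].
    move: (traject nxt (nxt d0) m) => t.
    elim: t (d0) => //= d1 t IH d /and3P[gd gd1 gt] /andP[/eqP dd1 pt].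
    rewrite IH ?gd1 // andbT; have /and3P[] := nxtP _ gd; by rewrite dd1.
  rewrite last_traject.
  by rewrite /= [X in X == _](Ex m) /x cl.
- apply/(uniqP (d0.2)) => i j; rewrite !inE size_map size_traject !ltnS => im jm.
  rewrite !nth_s // => E; case: (ltngtP i j) => // lt.
    by case: (@inj_e i j _ E); rewrite lt.
  by case: (@inj_e j i _ (esym E)); rewrite lt.
- apply/(uniqP (d0.1)) => i j; rewrite !inE size_map size_traject !ltnS => im jm.
  by rewrite !nth_s //; apply: inj_v.
Qed.

(** A forest has fewer edges than vertices. Deleting a vertex of inner degree at most 1 preserves
    the inequality; if there is none, [min_degree_cycle] applies. *)
Lemma dense_cycle S : S != set0 -> #|S| <= #|inner S| -> exists s, cycle_in S setT s.
Proof.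
have [n] := ubnP #|S|; elim: n => // n IH in S *; rewrite ltnS => Sn S0 dS.
have [/forallP degS|] := boolP [forall v in S, 1 < #|edges_at v :&: inner S|].
  have [|v vS|s [cs sS _]] := @min_degree_cycle S (inner S) S0.
  - by move=> e; rewrite inE.
  - by have /implyP := degS v; apply.
  - by exists s; split=> // e; rewrite inE.
rewrite negb_forall_in => /exists_inP[v vS]; rewrite -leqNgt => deg1.
have sub : inner (S :\ v) \subset inner S.
  by apply/subsetP => e; rewrite !inE => /subset_trans-> //; apply: subD1set.
have le : #|inner S| <= #|inner (S :\ v)| + 1.
  rewrite -(cardsID (edges_at v) (inner S)) addnC setIC leq_add // subset_leq_card //.
  apply/subsetP=> e; rewrite !inE => /andP[nv /subsetP eS]; apply/subsetP=> u ue.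
  by rewrite !inE eS // andbT; apply: contraNneq nv => <-.
have cS := cardsD1 v S; rewrite vS in cS.
(* The deletion cannot exhaust [S]: without loops a single vertex spans no edge, against [dS]. *)
have [S'0|S'0] := eqVneq (S :\ v) set0.
  move: dS le; rewrite cS S'0 cards0.
  suff -> : inner S = set0 by rewrite cards0.
  apply/setP=> e; rewrite !inE; apply/negP=> /subset_leq_card.
  by rewrite card_ends cS S'0 cards0.
have [|//||s [cs sS sF]] := IH (S :\ v); [lia|lia|].
by exists s; split=> // u /sS; rewrite inE => /andP[].
Qed.

(** * Closed trails and cycles as sequences of darts *)

Lemma walk_verts_in s d : d \in s -> d.1 \in walk_verts s.
Proof. by move=> ds; apply/mapP; exists d. Qed.

Lemma walk_edges_in s d : d \in s -> d.2 \in walk_edges s.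
Proof. by move=> ds; apply/mapP; exists d. Qed.

Lemma closed_walk_next s d : closed_walk s -> d \in s ->
  ends d.2 = [set d.1; (next s d).1].
Proof. by move=> cs ds; apply/eqP; apply: (next_cycle cs ds). Qed.

Lemma closed_walk_prev s d : closed_walk s -> d \in s ->
  ends (prev s d).2 = [set (prev s d).1; d.1].
Proof. by move=> cs ds; apply/eqP; apply: (prev_cycle cs ds). Qed.

Lemma closed_walk_verts s e v :
  closed_walk s -> e \in walk_edges s -> v \in ends e -> v \in walk_verts s.
Proof.
move=> cs /mapP[d ds ->]; rewrite (closed_walk_next cs ds) !inE => /orP[]/eqP->.
  exact: walk_verts_in.
by apply: walk_verts_in; rewrite mem_next.
Qed.

Lemma closed_trail_uniq s : closed_trail s -> uniq s.
Proof. by case/andP=> _; apply: map_uniq. Qed.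

Lemma trail_edge_inj s d d' : closed_trail s -> d \in s -> d' \in s -> d.2 = d'.2 -> d = d'.
Proof.
case/andP=> _ Us ds d's E.
have := @uniqP _ d.2 _ Us (index d s) (index d' s).
rewrite !inE size_map !index_mem !(nth_map d) ?index_mem // !nth_index //.
by move=> /(_ ds d's E) /(congr1 (nth d s)); rewrite !nth_index.
Qed.

Lemma cycle_vert_inj s d d' : is_cycle s -> d \in s -> d' \in s -> d.1 = d'.1 -> d = d'.
Proof.
case/and3P=> _ _ Us ds d's E.
have := @uniqP _ d.1 _ Us (index d s) (index d' s).
rewrite !inE size_map !index_mem !(nth_map d) ?index_mem // !nth_index //.
by move=> /(_ ds d's E) /(congr1 (nth d s)); rewrite !nth_index.
Qed.

Lemma trail_prev_neq s d : closed_trail s -> d \in s -> (prev s d).2 != d.2.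
Proof.
move=> ts ds; have cs : closed_walk s by case/andP: ts.
apply/eqP=> /(trail_edge_inj ts) E; have := closed_walk_prev cs ds.
rewrite E ?mem_prev // => /ends_neq.
by rewrite eqxx.
Qed.

Lemma cycle_edges_at s d : is_cycle s -> d \in s ->
  edges_at d.1 :&: [set e in walk_edges s] = [set (prev s d).2; d.2].
Proof.
move=> ics ds; have /and3P[_ ts Uv] := ics; have cs : closed_walk s by case/andP: ts.
have Us := closed_trail_uniq ts.
apply/setP=> e; rewrite !inE; apply/andP/orP => [[de /mapP[d' d's Ee]]|].
  move: de; rewrite Ee (closed_walk_next cs d's) !inE => /orP[]/eqP/(cycle_vert_inj ics) E.
    by right; rewrite E.
  by left; rewrite E ?mem_next // prev_next.
have pE := closed_walk_prev cs ds; have nE := closed_walk_next cs ds.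
by case=> /eqP->; rewrite ?pE ?nE !inE eqxx ?orbT; split=> //; apply: walk_edges_in; rewrite ?mem_prev.
Qed.

Lemma cycle_degree s v : is_cycle s -> v \in walk_verts s ->
  #|edges_at v :&: [set e in walk_edges s]| = 2.
Proof.
move=> ics /mapP[d ds ->]; rewrite cycle_edges_at // cards2 trail_prev_neq //.
by case/and3P: ics.
Qed.

Lemma cycle_degree0 s v : is_cycle s -> v \notin walk_verts s ->
  edges_at v :&: [set e in walk_edges s] = set0.
Proof.
case/and3P=> _ /andP[cs _] _ vs; apply/setP=> e; rewrite !inE.
apply/negP=> /andP[ve es]; case/negP: vs; exact: closed_walk_verts ve.
Qed.

Lemma closed_walk_connect s F u v : closed_trail s -> {subset walk_edges s <= F} ->
  u \in walk_verts s -> v \in walk_verts s -> connect (sadj setT F) u v.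
Proof.
move=> ts sF /mapP[d ds ->] /mapP[d' d's ->]; have /andP[cs _] := ts.
pose A := [pred a : vert G * edge G | connect (sadj setT F) d.1 a.1].
suff : d' \in A by [].
apply: (@cycle_in_next _ s A (closed_trail_uniq ts) _ d d'); rewrite ?inE //.
move=> a sa; rewrite !inE => da; apply: connect_trans da _; apply: connect1.
apply/sadjTP; exists a.2; first by apply/sF/walk_edges_in.
exact: closed_walk_next.
Qed.

(** A cycle inside [F] already uses both [F]-edges at each of its vertices, so its vertex set is
    closed under [F]-adjacency; by connectivity it contains every vertex that [F] touches. *)
Lemma two_regular_cycle F :
    F != set0 ->
    (forall v, #|edges_at v :&: F| = 0 \/ #|edges_at v :&: F| = 2) ->
    (forall u v, edges_at u :&: F != set0 -> edges_at v :&: F != set0 ->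
       connect (sadj setT F) u v) ->
  exists s, [/\ is_cycle s, {subset walk_edges s <= F} &
    forall v, edges_at v :&: F != set0 -> v \in walk_verts s].
Proof.
case/set0Pn=> e0 e0F deg con.
pose U := [set v | edges_at v :&: F != set0].
have FU e : e \in F -> ends e \subset U.
  move=> eF; apply/subsetP=> v ve; rewrite inE; apply/set0Pn; exists e.
  by rewrite !inE ve.
have [|//|v|s [ics sU sF]] := @min_degree_cycle U F.
- have [u [v [_ E]]] := endsE e0; apply/set0Pn; exists u.
  by apply: (subsetP (FU _ e0F)); rewrite E !inE eqxx.
- by rewrite inE -card_gt0; case: (deg v) => ->.
have cs : closed_walk s by case/and3P: ics => _ /andP[].
exists s; split=> // v vF.
have [u us] : exists u, u \in walk_verts s.
  by case/and3P: (ics); case: (s) => // d t _ _ _; exists d.1; rewrite inE eqxx.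
have uF : edges_at u :&: F != set0 by have := sU u us; rewrite inE.
apply: (connect_in _ (con u v uF vF)) => // x y /sadjTP[e eF E] xs.
apply: (@closed_walk_verts _ e) => //; last by rewrite E !inE eqxx orbT.
have : edges_at x :&: [set e in walk_edges s] = edges_at x :&: F.
  apply/eqP; rewrite eqEcard cycle_degree // setIS.
    by case: (deg x) => ->.
  by apply/subsetP=> f; rewrite inE; apply: sF.
move/setP/(_ e); rewrite !inE eF E !inE eqxx /= => ->.
by [].
Qed.

(** No edge of either cycle lies in [cut S], so each cycle stays within one component after the cut
    is removed, and these two components are not trees. *)
Lemma cyclic4_cut : cyclically_edge_connected G 4 ->
  forall S s1 s2, cycle_in S setT s1 -> cycle_in (~: S) setT s2 -> 4 <= #|cut S|.
Proof.
case=> conG lamG S s1 s2 [c1 v1 _] [c2 v2 _]; rewrite leqNgt; apply/negP=> lt4.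
have two : two_disjoint_cycles G.
  by exists s1, s2; split=> // v /v1 vS; apply/negP=> /v2; rewrite inE vS.
(* [lamG] only speaks of the minimum size of a cyclic edge cut; a descent on the size leads from any
   cyclic edge cut with fewer than four edges to a minimum one. *)
have small n (A : {set edge G}) : #|A| <= n -> #|A| < 4 -> cyclic_edge_cut A -> False.
  elim: n A => [|n IH] A An A4 cA;
    suff /(lamG two) : lambda_c G #|A| by rewrite leqNgt A4.
    split; first by exists A.
    by move=> B _; move: An; rewrite leqn0 => /eqP->.
  split; first by exists A.
  move=> B cB; rewrite leqNgt; apply/negP=> BA.
  by apply: (IH B) => //; [lia|lia].
apply: (small _ _ (leqnn _) lt4) => {small}.
have Scl x y : sadj setT (~: cut S) x y -> (x \in S) = (y \in S).
  by move=> /sadjTP[e]; rewrite inE => + E; rewrite (cutE _ E); do 2 case: (_ \in S).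
have Scon x y : connect (sadj setT (~: cut S)) x y -> (x \in S) = (y \in S).
  move=> xy; apply/idP/idP; last rewrite connect_sadjC in xy.
    by apply: (connect_in _ xy) => u v /Scl->.
  by apply: (connect_in _ xy) => u v /Scl->.
have start s : is_cycle s -> exists u, u \in walk_verts s.
  by case/and3P; case: s => // d t _ _ _; exists d.1; rewrite inE eqxx.
have [u1 us1] := start _ c1; have [u2 us2] := start _ c2.
have u1S := v1 _ us1; have := v2 _ us2; rewrite inE => u2S.
have tree s u : is_cycle s -> u \in walk_verts s ->
    (forall v, v \in walk_verts s -> (v \in S) = (u \in S)) ->
    ~ is_tree [set w in setT | connect (sadj setT (~: cut S)) u w] (~: cut S).
  move=> cs us sS [_ []]; exists s.
  have sF : {subset walk_edges s <= ~: cut S}.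
    move=> e es; rewrite inE; have [x [y [_ E]]] := endsE e.
    have cw : closed_walk s by case/and3P: cs => _ /andP[].
    rewrite (cutE _ E) !sS ?addbb //; apply: (closed_walk_verts cw es);
      by rewrite E !inE eqxx ?orbT.
  split=> // v vs; rewrite !inE; apply: closed_walk_connect sF us vs.
  by case/and3P: cs.
split.
  by case=> _ /(_ u1 u2 (in_setT _) (in_setT _)) /Scon; rewrite u1S (negPf u2S).
exists [set w in setT | connect (sadj setT (~: cut S)) u1 w],
  [set w in setT | connect (sadj setT (~: cut S)) u2 w]; split.
- exact: imset_f.
- exact: imset_f.
- apply/eqP=> /setP/(_ u1); rewrite !inE connect0 /= => /esym/Scon.
  by rewrite u1S (negPf u2S).
- by apply: (tree s1) => // v /v1->; rewrite u1S.
- by apply: (tree s2) => // v /v2; rewrite inE => /negPf->; rewrite (negPf u2S).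
Qed.

Lemma cycle_verts_gt1 S s : cycle_in S setT s -> 1 < #|S|.
Proof.
case=> ics sS _; have /and3P[s0 /andP[cs _] _] := ics.
case: s s0 ics sS cs => // d t _ _ sS cs.
have E := closed_walk_next cs (mem_head _ _).
have := card_ends d.2; rewrite E => <-; apply: subset_leq_card.
rewrite subUset !sub1set !sS // walk_verts_in ?mem_next //; exact: mem_head.
Qed.

Lemma connected_cut : vert G -> (forall S, S != set0 -> ~: S != set0 -> cut S != set0) ->
  connected G.
Proof.
move=> v0 H; split; first by apply/set0Pn; exists v0.
move=> u v _ _; pose S := [set w | connect (sadj setT setT) u w].
suff : v \in S by rewrite inE.
apply/negPn/negP=> vS; have [||e] := set0Pn _ (H S _ _).
- by apply/set0Pn; exists u; rewrite inE.
- by apply/set0Pn; exists v; rewrite inE.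
have [x [y [_ E]]] := endsE e; rewrite (cutE _ E) !inE.
suff -> : connect (sadj setT setT) u x = connect (sadj setT setT) u y by rewrite addbb.
have xy : sadj setT setT x y by apply/sadjTP; exists e.
apply/idP/idP => c; apply: connect_trans c _; apply: connect1 => //.
by rewrite sadj_sym.
Qed.

(** A component with a single vertex is a tree, so both non-tree components have at least two
    vertices; and every edge leaving a component of [G] minus [A] belongs to [A]. *)
Lemma cyclic4_intro : connected G ->
    (forall S, 1 < #|S| -> 1 < #|~: S| -> 4 <= #|cut S|) ->
  cyclically_edge_connected G 4.
Proof.
move=> conG H; split=> // _ n [[A [_ [C1 [C2 [C1c C2c C12 t1 t2]]]] <-] _].
rewrite leqNgt; apply/negP=> A4.
pose cl u := [set w in setT | connect (sadj setT (~: A)) u w].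
have clP u v : (v \in cl u) = connect (sadj setT (~: A)) u v by rewrite !inE.
have gt1 u : ~ is_tree (cl u) (~: A) -> 1 < #|cl u|.
  move=> nt; rewrite ltnNge; apply/negP=> le1; apply: nt; split; last first.
    case=> s [ics sC _]; have : 1 < #|cl u|.
      by apply: (@cycle_verts_gt1 _ s); split=> // e; rewrite inE.
    by rewrite ltnNge le1.
  have uu : u \in cl u by rewrite clP.
  split; first by apply/set0Pn; exists u.
  by move=> v w vC wC; rewrite (card_le1_eqP le1 _ _ vC wC).
case/imsetP: C1c t1 C12 => u1 _ -> /gt1 gt11; case/imsetP: C2c t2 => u2 _ -> /gt1 gt12 C12.
suff le : #|cut (cl u1)| <= #|A|.
  suff : 4 <= #|cut (cl u1)| by lia.
  apply: H => //; apply: leq_trans gt12 (subset_leq_card _).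
  apply/subsetP=> w; rewrite in_setC !clP => u2w; apply/negP=> u1w.
  case/eqP: C12; apply/setP=> z; rewrite !clP.
  have u12 : connect (sadj setT (~: A)) u1 u2.
    by apply: connect_trans u1w _; rewrite connect_sadjC.
  apply/idP/idP; last exact: connect_trans.
  by apply: connect_trans; rewrite connect_sadjC.
apply: subset_leq_card; apply/subsetP=> e; apply: contraLR => eA.
have [x [y [_ E]]] := endsE e; rewrite (cutE _ E) !clP.
have xy : sadj setT (~: A) x y by apply/sadjTP; exists e; rewrite // inE.
suff -> : connect (sadj setT (~: A)) u1 x = connect (sadj setT (~: A)) u1 y by rewrite addbb.
apply/idP/idP => c; apply: connect_trans c _; apply: connect1 => //.
by rewrite sadj_sym.
Qed.

End Basics.

(** * Line graphs of cubic graphs *)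

Section Cubic.
Variable G : mgraph.
Hypothesis cubic : regular G 3.
Implicit Types (u v w : vert G) (e f : edge G) (S : {set vert G}).

Lemma cubic_handshake S : #|S| * 3 = #|inner S|.*2 + #|cut S|.
Proof.
have := handshake S setT; rewrite !setIT => <-.
rewrite -sum_nat_const; apply: eq_bigr => v _.
by rewrite setIT cubic.
Qed.

(** A side with [n >= 2] vertices and at most three leaving edges spans at least [n] edges: half of
    [3n - 3] suffices for [n >= 3], and parity settles [n = 2]. By [dense_cycle] both sides then
    contain cycles. *)
Lemma cyclic4_essential : cyclically_edge_connected G 4 ->
  forall S, 1 < #|S| -> 1 < #|~: S| -> 4 <= #|cut S|.
Proof.
move=> c4 S S1 S1'; rewrite leqNgt; apply/negP=> lt4.
have cyc (X : {set vert G}) : #|cut X| < 4 -> 1 < #|X| -> exists s, cycle_in X setT s.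
  move=> X4 X1; apply: dense_cycle; first by rewrite -card_gt0 ltnW.
  by have := cubic_handshake X; lia.
have [s1 c1] := cyc _ lt4 S1; have [|//|s2 c2] := cyc (~: S); first by rewrite cutC.
by have := cyclic4_cut c4 c1 c2; lia.
Qed.

Definition ldart := {d : vert G * edge G | d.1 \in ends d.2}.

Lemma ldart_card (d : ldart) : #|edges_at (val d).1 :\ (val d).2| = 2.
Proof.
have := cardsD1 (val d).2 (edges_at (val d).1); rewrite cubic inE (valP d).
by case.
Qed.

(* An edge of the line graph joins two edges of G that share a vertex v; as G is
   cubic, it is determined by v and the third edge at v. *)
Definition line_graph := @MGraph (edge G) ldart
  (fun d => edges_at (val d).1 :\ (val d).2) ldart_card.

Local Notation H := line_graph.
Implicit Types (d : edge H).

Definition lv d : vert G := (val (d : ldart)).1.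
Definition le d : edge G := (val (d : ldart)).2.

Lemma lineE d e : (e \in ends d) = (e != le d) && (lv d \in ends e).
Proof. by rewrite !inE. Qed.

Lemma ldartP d : lv d \in ends (le d).
Proof. exact: valP d. Qed.

Lemma ldart_eq d d' : lv d = lv d' -> le d = le d' -> d = d'.
Proof.
case: d => -[v e] p; case: d' => -[v' e'] p'; rewrite /lv /le /= => E1 E2.
by apply: val_inj; rewrite /= E1 E2.
Qed.

(** The two fans of [e], one for each of its ends, are going to be its two transitions. *)
Definition fan v e : {set edge H} := [set d in edges_at (e : vert H) | lv d == v].

Lemma fanE v e d : (d \in fan v e) = [&& lv d == v, e != le d & v \in ends e].
Proof.
rewrite !inE -/(lv d) -/(le d).
by case: (lv d =P v) => [->|]; rewrite ?andbF ?andbT.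
Qed.

Lemma card_fan v e : v \in ends e -> #|fan v e| = 2.
Proof.
move=> ve; have <- : #|edges_at v :\ e| = 2.
  by have := cardsD1 e (edges_at v); rewrite cubic inE ve; case.
rewrite -(card_in_imset (f := le)).
  apply: eq_card => f; apply/imsetP/idP => [[d]|].
    rewrite fanE => /and3P[/eqP<- ed _] ->.
    by rewrite !inE eq_sym ed ldartP.
  rewrite !inE => /andP[fe vf]; exists (exist _ (v, f) vf : edge H) => //.
  by rewrite fanE /lv /le /= eqxx eq_sym fe.
move=> d d'; rewrite !fanE => /andP[/eqP E _] /andP[/eqP E' _]; apply: ldart_eq.
by rewrite E E'.
Qed.

Lemma edges_at_line e u v : ends e = [set u; v] ->
  edges_at (e : vert H) = fan u e :|: fan v e.
Proof.
move=> E; apply/setP=> d; rewrite [RHS]inE !fanE inE lineE E !inE !eqxx orbT !andbT /=.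
rewrite -andb_orl andbC; congr (_ && _).
Qed.

Lemma disjoint_fan e u v : u != v -> [disjoint fan u e & fan v e].
Proof.
move=> uv; rewrite -setI_eq0; apply/eqP/setP=> d; rewrite inE !fanE in_set0.
by case: eqP => // ->; rewrite (negPf uv) andbF.
Qed.

Lemma line_regular : regular H 4.
Proof.
move=> e; have [u [v [uv E]]] := endsE (e : edge G).
rewrite (edges_at_line E) cardsU (eqP (_ : _ :&: _ == set0)); last first.
  by rewrite setI_eq0 disjoint_fan.
by rewrite cards0 !card_fan // E !inE eqxx ?orbT.
Qed.

Lemma line_adj e f v : e != f -> v \in ends e -> v \in ends f ->
  exists d : edge H, ends d = [set (e : vert H); f].
Proof.
move=> ef ve vf; have [t] : exists t, t \in (edges_at v :\ e) :\ f.
  apply/card_gt0P; have := cardsD1 e (edges_at v); rewrite cubic inE ve.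
  have := cardsD1 f (edges_at v :\ e); rewrite !inE eq_sym ef vf.
  by lia.
rewrite !inE => /and3P[tf te vt].
exists (exist _ (v, t) vt : edge H); apply/esym/eqP; rewrite eqEcard cards2 ef card_ends andbT.
by apply/subsetP=> g; rewrite !inE => /orP[]/eqP->; rewrite /= ?ve ?vf eq_sym ?te ?tf.
Qed.

Lemma edges_gt4 : 3 < #|vert G| -> 4 < #|edge G|.
Proof.
have := cubic_handshake setT; rewrite cardsT.
suff -> : cut [set: vert G] = set0.
  rewrite cards0; have : #|inner [set: vert G]| <= #|edge G| by apply: max_card.
  by lia.
apply/setP=> e; have [u [v [_ E]]] := endsE e.
by rewrite (cutE _ E) !inE.
Qed.

(** Suppose [X] separates [e] from [f]; let [A] be the edges reachable from [e] and [S] the set of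
    their ends. The ends of [f] avoid [S], and an edge leaving [S] outside [X] would be adjacent to
    [A], hence in it. So [cut S] is contained in [X]. *)
Lemma line_connected : 3 < #|vert G| ->
    (forall S, 1 < #|S| -> 1 < #|~: S| -> 4 <= #|cut S|) ->
  k_connected H 4.
Proof.
move=> V4 ess; have E5 := edges_gt4 V4; split=> // X X4; split.
  rewrite -card_gt0 -(ltn_add2l #|X|) addn0 cardsC; exact: leq_trans X4 (ltnW E5).
move=> e f eX fX; apply/negPn/negP => ef.
pose A := [set g | connect (sadj (~: X) setT) e g] : {set edge G}.
have AX g : g \in A -> g \notin X.
  rewrite inE => c; have : g \in ~: X; last by rewrite inE.
  by apply: (connect_in _ c) => // x y /and3P[].
have Acl g h v : g \in A -> h \notin X -> v \in ends g -> v \in ends h -> h \in A.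
  move=> gA hX vg vh; have [<- //|gh] := eqVneq g h.
  have [d E] := line_adj gh vg vh; move: (gA); rewrite !inE => c.
  apply: connect_trans c (connect1 _).
  apply/and3P; split; rewrite ?inE ?hX ?(AX _ gA) //.
  by apply/existsP; exists d; rewrite E eqxx andbT inE.
pose S := [set v | [exists g in A, v \in ends g]].
have SP v g : g \in A -> v \in ends g -> v \in S.
  by move=> gA vg; rewrite inE; apply/existsP; exists g; rewrite gA.
have eA : e \in A by rewrite inE.
have fA : f \notin A by rewrite inE.
have S1 : 1 < #|S|.
  by rewrite -(card_ends (e : edge G)) subset_leq_card //; apply/subsetP=> v; apply: SP.
have S2 : 1 < #|~: S|.
  rewrite -(card_ends (f : edge G)) subset_leq_card //; apply/subsetP=> v vf.
  rewrite !inE; apply/negP=> /existsP[g /andP[gA vg]]; case/negP: fA.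
  by apply: Acl gA _ vg vf; move: fX; rewrite inE.
have := ess _ S1 S2; suff /subset_leq_card sX : cut S \subset X.
  by move/leq_trans=> /(_ _ sX); rewrite leqNgt X4.
apply/subsetP=> h; apply: contraLR => hX.
have cl v : v \in ends h -> v \in S -> h \in A.
  by move=> vh; rewrite inE => /existsP[g /andP[gA vg]]; apply: Acl gA hX vg vh.
have [x [y [_ E]]] := endsE h; rewrite (cutE _ E).
have xh : x \in ends h by rewrite E !inE eqxx.
have yh : y \in ends h by rewrite E !inE eqxx orbT.
have -> : (x \in S) = (y \in S); last by rewrite addbb.
by apply/idP/idP => [/(cl _ xh)|/(cl _ yh)] hA; apply: SP hA _.
Qed.

Definition line_transition (e : vert H) : {set {set edge H}} :=
  preim_partition lv (edges_at e).

Lemma line_transitionP e P :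
  reflect (exists2 v, v \in ends e & P = fan v e) (P \in line_transition e).
Proof.
apply: (iffP imsetP) => [[d de ->]|[v ve ->]].
  exists (lv d); first by move: de; rewrite inE lineE => /andP[].
  by apply/setP=> d'; rewrite !inE (eq_sym (lv d')).
have /card_gt0P[d dv] : 0 < #|fan v e| by rewrite card_fan.
have [de /eqP Ed] : d \in edges_at (e : vert H) /\ lv d == v.
  by move: dv; rewrite 2!inE => /andP[].
by exists d => //; apply/setP=> d'; rewrite !inE (eq_sym (lv d')) Ed.
Qed.

Lemma line_transition_system : transition_system line_transition.
Proof.
move=> e; split; first exact: preim_partitionP.
by move=> P /line_transitionP[v ve ->]; apply: card_fan.
Qed.

Lemma edges_at_cubic v : exists a b c, uniq [:: a; b; c] /\ edges_at v =i [:: a; b; c].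
Proof.
have: size (enum (edges_at v)) = 3 by rewrite -cardE cubic.
have := enum_uniq (edges_at v); have E := mem_enum (edges_at v).
case: (enum _) E => [|a [|b [|c [|]]]] // E U _; exists a, b, c; by split.
Qed.

(** * From a trail of the line graph to a dominating cycle *)

Section FromTrail.
Variable s : seq (vert H * edge H).
Hypothesis Ts : T_trail line_transition s.
Hypothesis E5 : 4 < #|edge G|.

Let K : {set edge H} := [set d in walk_edges s].

Lemma trail_ct : closed_trail s. Proof. by case: Ts. Qed.
Lemma trail_cw : closed_walk s. Proof. by case/andP: trail_ct. Qed.

(* If the trail makes both transitions at an edge e, a visit to e inside the
   fan of v leaves e inside the same fan. *)
Lemma trail_turn (d : vert H * edge H) : d \in s -> let e := (next s d).1 in
  #|edges_at e :&: K| = 2 \/ lv d.2 = lv (next s d).2.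
Proof.
move=> ds e; have [_ _ /(_ e)] := Ts; rewrite setIdE => -[k2|fol]; [by left|right].
have cw := trail_cw; have ct := trail_ct.
have de : e \in ends d.2 by rewrite (closed_walk_next cw ds) !inE eqxx orbT.
have [_ ve] : e != le d.2 /\ lv d.2 \in ends (e : edge G).
  by move: de; rewrite lineE => /andP[].
have [a sa Ea] : follows s (fan (lv d.2) e).
  by apply: fol; apply/line_transitionP; exists (lv d.2).
have nas : next s a \in s by rewrite mem_next.
have dP : d.2 \in fan (lv d.2) e by rewrite fanE eqxx; move: de; rewrite lineE.
have aP : a.2 \in fan (lv d.2) e by rewrite Ea !inE eqxx.
have bP : (next s a).2 \in fan (lv d.2) e by rewrite Ea !inE eqxx orbT.
move: (dP); rewrite Ea !inE => /orP[]/eqP /(trail_edge_inj ct ds) Ed.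
  by move: bP; rewrite -Ed // fanE => /andP[/eqP].
(* Here d is the second of the two consecutive darts, so both ends of d.2 are e. *)
have ab : (next s a).1 = e.
  apply/eqP; apply: contraTT isT => ne; exfalso.
  have bE : (next s a).1 \in ends a.2 by rewrite (closed_walk_next cw sa) !inE eqxx orbT.
  have bE' : (next s a).1 \in ends (next s a).2.
    by rewrite (closed_walk_next cw nas) !inE eqxx.
  move: bE bE' aP bP; rewrite !lineE !fanE => /andP[n1 v1] /andP[n2 v2].
  move=> /and3P[/eqP va ea _] /and3P[/eqP vb eb _].
  (* Both line graph edges join [e] to the edge [(next s a).1] at the vertex [lv d.2], so both carry
     the third edge there as label and coincide, although the fan has two elements. *)
  have : a.2 != (next s a).2.
    by have := card_fan ve; rewrite Ea cards2; case: eqP.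
  apply/negP; rewrite negbK; apply/eqP/ldart_eq; first by rewrite va vb.
  have : #|edges_at (lv d.2)| = 3 := cubic _.
  have v1' : lv d.2 \in ends ((next s a).1 : edge G) by rewrite -va.
  rewrite (cardsD1 e) inE ve (cardsD1 (next s a).1) !inE ne v1' => -[] k1.
  have in1 (b : edge H) : lv b = lv d.2 -> e != le b -> (next s a).1 != le b ->
      le b \in (edges_at (lv d.2) :\ e) :\ (next s a).1.
    by move=> vb' eb' nb; rewrite !inE -vb' ldartP ![le b == _]eq_sym (negPf eb') (negPf nb).
  have /card_le1_eqP le1 : #|(edges_at (lv d.2) :\ e) :\ (next s a).1| <= 1 by move: k1; rewrite !add0n => ->.
  by apply: le1; apply: in1.
have := closed_walk_next cw ds; rewrite Ed // in ab *.
by rewrite ab => /ends_neq; rewrite /e Ed // eqxx.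
Qed.

Lemma line_visited (e : edge G) : exists2 a, a \in s & a.1 = e.
Proof. by have [_ /(_ e)/mapP[a sa ->] _] := Ts; exists a. Qed.

Lemma mem_K a : a \in s -> a.2 \in K.
Proof. by move=> sa; rewrite inE; apply: walk_edges_in. Qed.

Lemma KP d : d \in K -> exists2 a, a \in s & a.2 = d.
Proof. by rewrite inE => /mapP[a sa ->]; exists a. Qed.

Let k v e := #|fan v e :&: K|.

Lemma k_cases e u v : ends e = [set u; v] ->
  k u e + k v e = 2 \/ k u e = 2 /\ k v e = 2.
Proof.
move=> E; have uv := ends_neq E; have [_ _ /(_ e)] := Ts; rewrite setIdE.
have -> : [set x | x \in walk_edges s] = K by [].
case=> [k2|fol]; [left|right].
  have dis : (fan u e :&: K) :&: (fan v e :&: K) = set0.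
    by rewrite setIACA (disjoint_setI0 (disjoint_fan e uv)) set0I.
  by rewrite -k2 (edges_at_line E) setIUl cardsU dis cards0 subn0.
have full w : w \in ends e -> k w e = 2.
  move=> we; rewrite /k (setIidPl _) ?card_fan //.
  have [|a sa ->] := fol (fan w e); first by apply/line_transitionP; exists w.
  by rewrite subUset !sub1set !mem_K ?mem_next.
by rewrite !full // E !inE eqxx ?orbT.
Qed.

(** By [k_cases], a fan of [e] used exactly once forces the other fan to be used exactly once: the
    trail crosses [e] from one end to the other. These edges form the dominating cycle. *)
Let F := [set e | [exists v in ends e, k v e == 1]].

Lemma mem_F e v : v \in ends e -> (e \in F) = (k v e == 1).
Proof.
move=> ve; rewrite inE; apply/existsP/idP => [[u /andP[ue /eqP ku]]|kv]; last first.
  by exists v; rewrite ve.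
have [w _ E] := ends_other ue; move: ve; rewrite E !inE => /orP[]/eqP->.
  by rewrite ku.
by apply/eqP; have := k_cases E; lia.
Qed.

Let used v t := [exists d in K, (lv d == v) && (le d == t)].

Lemma k_used v e : v \in ends e -> k v e = \sum_(t in edges_at v | t != e) used v t.
Proof.
move=> ve; rewrite -big_mkcondr /= sum1_card /k -(card_in_imset (f := le)).
  apply: eq_card => t; apply/imsetP/idP => [[d]|].
    rewrite inE fanE => /andP[/and3P[/eqP<- ed _] dK] ->.
    rewrite unfold_in inE ldartP eq_sym ed /=.
    by apply/existsP; exists d; rewrite dK !eqxx.
  rewrite unfold_in inE => /andP[/andP[vt te] /existsP[d /and3P[dK /eqP dv /eqP dt]]].
  by exists d; rewrite // inE fanE dv dt eqxx eq_sym te ve dK.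
move=> d d'; rewrite !(inE, fanE) => /andP[/andP[/eqP dv _] _] /andP[/andP[/eqP d'v _] _].
by apply: ldart_eq; rewrite dv.
Qed.

(** Among the edges [x], [y], [z] at [v], membership of [x] in [F] means that [used v] differs at
    [y] and [z]. Three bits differ in exactly two of their pairs, or in none when all are equal. *)
Lemma degree_F v : #|edges_at v :&: F| = 2 \/
  #|edges_at v :&: F| = 0 /\ exists b : bool, forall t, t \in edges_at v -> used v t = b.
Proof.
have [x [y [z [U E]]]] := edges_at_cubic v.
have vs t : t \in [:: x; y; z] -> v \in ends t by rewrite -E inE.
have sumE (f : edge G -> nat) (P : pred (edge G)) :
    \sum_(t in edges_at v | P t) f t = \sum_(t <- [:: x; y; z] | P t) f t.
  by rewrite big_mkcondr [RHS]big_mkcond big_uniq //; apply: eq_bigl.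
have -> : #|edges_at v :&: F| = \sum_(t in edges_at v | true) (k v t == 1).
  rewrite -sum1_card big_mkcond [RHS]big_mkcond /=; apply: eq_bigr => t _; rewrite andbT.
  by rewrite inE; case: (boolP (t \in edges_at v)) => //; rewrite inE => /mem_F ->; case: eqP.
rewrite sumE !big_cons big_nil /=.
rewrite !k_used ?vs ?inE ?eqxx ?orbT // !sumE !big_cons !big_nil !eqxx /=.
move: U; rewrite /= !inE !negb_or => /and3P[/andP[xy xz] yz _].
rewrite xy xz yz ![_ == x]eq_sym ![z == y]eq_sym xy xz yz /=.
have same : used v x = used v y -> used v y = used v z ->
    exists b, forall t, t \in edges_at v -> used v t = b.
  by move=> xy1 yz1; exists (used v z) => t; rewrite E !inE => /or3P[]/eqP->; rewrite -?yz1.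
by case: (used v x) (used v y) (used v z) same => [] [] [] same; by [left|right; split=> //; apply: same].
Qed.

(** Otherwise all three line graph edges coming from [v] are used, and no edge at [v] is crossed.
    The trail can then never leave the fans of [v], so it visits only the three edges at [v], while
    [G] has at least five. *)
Lemma covered d : d \in K -> edges_at (lv d) :&: F != set0.
Proof.
move=> dK; set v := lv d; rewrite -card_gt0.
case: (degree_F v) => [->//|[_ [b allb]]].
have b1 : b by rewrite -(allb (le d)) ?inE ?ldartP //; apply/existsP; exists d; rewrite dK !eqxx.
have k2 e : v \in ends e -> k v e = 2.
  move=> ve; rewrite k_used // (eq_bigr (fun=> 1)) => [|t /andP[vt _]]; last by rewrite allb ?b1.
  rewrite sum1_card; have := cardsD1 e (edges_at v); rewrite cubic inE ve => -[E2].
  by rewrite [RHS]E2; apply: eq_card => t; rewrite unfold_in !inE andbC.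
have [a0 sa0 Ea0] := KP dK.
have stay : forall a, a \in s -> lv a.2 == v.
  move=> a sa; have := @cycle_in_next _ s [pred a | lv a.2 == v] (closed_trail_uniq trail_ct) _ a0 a sa0 sa.
  apply; last by rewrite inE Ea0.
  move=> c sc; rewrite !inE => /eqP cv; have /= [K2|<-] := trail_turn sc; last by rewrite cv.
  set e := (next s c).1 in K2.
  have ve : v \in ends (e : edge G).
    by have := next_cycle trail_cw sc => /= /eqP/setP/(_ e); rewrite lineE !inE eqxx orbT cv => /andP[].
  have EK : fan v e :&: K = edges_at e :&: K.
    apply/eqP; rewrite eqEcard K2 -[X in _ <= X]/(k v e) k2 // andbT setSI //.
    by apply/subsetP=> x; rewrite inE => /andP[].
  have : (next s c).2 \in edges_at e :&: K.
    rewrite inE mem_K ?mem_next // andbT inE.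
    by rewrite (closed_walk_next trail_cw) ?mem_next // !inE eqxx.
  by rewrite -EK inE fanE => /andP[/and3P[]].
have sub : [set: edge G] \subset edges_at v.
  apply/subsetP=> e _; have [a sa <-] := line_visited e.
  have := closed_walk_next trail_cw sa => /setP/(_ a.1); rewrite lineE !inE eqxx /=.
  by rewrite (eqP (stay _ sa)) => /andP[].
by have := subset_leq_card sub; rewrite cubic cardsT; lia.
Qed.

(** If consecutive trail edges come from different vertices [u] and [w], they meet in an edge [e]
    joining [u] and [w]. Both fans of [e] are used, with two uses in total, so each is used once and
    [e] lies in [F]. *)
Lemma trail_connected a : a \in s ->
  connect (sadj setT F) (lv a.2) (lv (next s a).2).
Proof.
move=> sa; have /= [K2|<-] := trail_turn sa; last exact: connect0.
set e := (next s a).1 in K2; set u := lv a.2; set w := lv (next s a).2.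
have [->|uw] := eqVneq u w; first exact: connect0.
have ue : a.2 \in fan u e.
  have : e \in ends a.2 by rewrite (closed_walk_next trail_cw sa) !inE eqxx orbT.
  by rewrite lineE fanE eqxx.
have we : (next s a).2 \in fan w e.
  have : e \in ends (next s a).2 by rewrite (closed_walk_next trail_cw) ?mem_next // !inE eqxx.
  by rewrite lineE fanE eqxx.
have /and3P[_ _ ue'] : [&& u == u, e != le a.2 & u \in ends e] by move: ue; rewrite fanE.
have /and3P[_ _ we'] : [&& w == w, e != le (next s a).2 & w \in ends e].
  by move: we; rewrite fanE.
have E : ends (e : edge G) = [set u; w].
  by apply/esym/eqP; rewrite eqEcard cards2 uw card_ends subUset !sub1set ue' we'.
apply: connect1; apply/sadjTP; exists e => //; rewrite (mem_F ue').
have ku : 0 < k u e by apply/card_gt0P; exists a.2; rewrite inE ue mem_K.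
have kw : 0 < k w e by apply/card_gt0P; exists (next s a).2; rewrite inE we mem_K ?mem_next.
have : k u e + k w e <= 2.
  rewrite -K2 /k -cardsUI.
  have -> : (fan u e :&: K) :&: (fan w e :&: K) = set0.
    by rewrite setIACA (disjoint_setI0 (disjoint_fan e uw)) set0I.
  by rewrite cards0 addn0 (edges_at_line E) setIUl.
lia.
Qed.

(** The trail leaves each edge [e] along a line graph edge that comes from an end of [e]; by
    [covered] this end lies on the cycle formed by [F]. *)
Lemma dominating_of_trail : exists c : seq (vert G * edge G), dominating_cycle c.
Proof.
have /card_gt0P[e0 _] : 0 < #|edge G| by apply: leq_trans E5.
have cov e : exists2 v, v \in ends e & edges_at v :&: F != set0.
  have [a sa Ea] := line_visited e; exists (lv a.2); last exact/covered/mem_K.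
  have := closed_walk_next trail_cw sa => /setP/(_ a.1); rewrite lineE !inE eqxx Ea.
  by case/andP.
have [|v|u v uF vF|c [ic _ cF]] := @two_regular_cycle G F.
- by have [v _ /set0Pn[e]] := cov e0; rewrite inE => /andP[_ eF]; apply/set0Pn; exists e.
- by case: (degree_F v) => [|[]]; [right|left].
- have dart w : edges_at w :&: F != set0 -> exists2 a, a \in s & lv a.2 = w.
    move=> /set0Pn[e]; rewrite inE => /andP[]; rewrite inE => we; rewrite (mem_F we) => /eqP k1.
    have /card_gt0P[d] : 0 < k w e by rewrite k1.
    rewrite inE fanE => /andP[/andP[/eqP dw _] /KP[a sa Ea]].
    by exists a; rewrite ?Ea.
  have [a sa <-] := dart u uF; have [b sb <-] := dart v vF.
  pose A := [pred c : vert H * edge H | connect (sadj setT F) (lv a.2) (lv c.2)].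
  have := @cycle_in_next _ s A (closed_trail_uniq trail_ct) _ a b sa sb.
  apply; rewrite ?inE // => c sc; rewrite !inE => ac; apply: connect_trans ac _.
  exact: trail_connected.
by exists c; split=> // e; have [v ve vF] := cov e; exists v => //; apply: cF.
Qed.

End FromTrail.

(** By parity such a graph has two vertices, and every edge joins them. It is treated apart because
    its line graph has only three vertices, too few for 4-connectedness. *)
Lemma small_dominating : connected G -> #|vert G| <= 3 ->
  exists c : seq (vert G * edge G), dominating_cycle c.
Proof.
move=> [/set0Pn[v0 _] _] V3; have := cubic_handshake setT; rewrite cardsT.
have -> : cut [set: vert G] = set0.
  by apply/setP=> e; have [u [v [_ E]]] := endsE e; rewrite (cutE _ E) !inE.
have V0 : 0 < #|vert G| by apply/card_gt0P; exists v0.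
rewrite cards0 => VE; have [||c [ic cV cE]] := @dense_cycle G setT.
- by rewrite -card_gt0 cardsT.
- by rewrite cardsT; lia.
have [v vc] : exists v, v \in walk_verts c.
  by case/and3P: ic; case: (c) => // d t _ _ _; exists d.1; rewrite inE eqxx.
exists c; split=> // e; exists v => //.
have : ends e = setT by apply/eqP; rewrite eqEcard subsetT cardsT card_ends; lia.
by move=> ->; rewrite inE.
Qed.

End Cubic.

Lemma dcc_of_nwc :
  (forall H : mgraph, regular H 4 -> k_connected H 4 ->
     forall T : vert H -> {set {set edge H}}, transition_system T -> T_hamiltonian T) ->
  forall G : mgraph, regular G 3 -> cyclically_edge_connected G 4 ->
    exists s : seq (vert G * edge G), dominating_cycle s.
Proof.
move=> nwc G cubic c4; have [conG _] := c4.
have [V3|V4] := leqP #|vert G| 3; first exact: small_dominating conG V3.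
have [s Ts] := nwc _ (@line_regular G cubic)
  (line_connected cubic V4 (cyclic4_essential cubic c4)) _ (@line_transition_system G cubic).
exact: dominating_of_trail Ts (edges_gt4 cubic V4).
Qed.

(** * Contracting the triangles that avoid a perfect matching *)

Section Contraction.
Variable G : mgraph.
Hypothesis cubic : regular G 3.
Variable M : {set edge G}.
Hypothesis matchM : forall v : vert G, #|edges_at v :&: M| = 1.
Implicit Types (u v w p q r : vert G) (e : edge G) (S X : {set vert G}).

(** The condition on the size of the cut excludes a matching edge inside [S]; with such an edge,
    only one edge would leave [S]. *)
Definition matched_triangle S := [/\ #|S| = 3, cut S \subset M & #|cut S| = 3].

(** As [M] is a perfect matching, removing it leaves a 2-regular graph. The triangles to contract
    are components of it, which makes them disjoint. *)
Definition comp p := [set q | connect (sadj setT (~: M)) p q].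
Definition contracted p := (#|comp p| == 3) && (#|cut (comp p)| == 3).
Definition block p := if contracted p then comp p else [set p].

Lemma comp_id p : p \in comp p. Proof. by rewrite inE. Qed.

Lemma comp_eq p q : q \in comp p -> comp q = comp p.
Proof.
rewrite inE => pq; apply/setP=> r; rewrite !inE; apply/idP/idP; apply: connect_trans => //.
by rewrite connect_sadjC.
Qed.

Lemma block_id p : p \in block p.
Proof. by rewrite /block; case: ifP; rewrite ?comp_id ?set11. Qed.

Lemma block_eq p q : q \in block p -> block q = block p.
Proof.
rewrite /block; case: ifP => [cp /comp_eq E|cp]; last by rewrite inE => /eqP->; rewrite cp.
by rewrite /contracted E -/(contracted p) cp.
Qed.

Lemma contracted_eq p q : q \in block p -> contracted q = contracted p.
Proof.
rewrite /block; case: ifP => [cp /comp_eq E|cp]; last by rewrite inE => /eqP->.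
by rewrite /contracted E -/(contracted p) cp.
Qed.

Lemma comp_edge p q e : e \notin M -> ends e = [set p; q] -> q \in comp p.
Proof. by move=> eM E; rewrite inE connect1 //; apply/sadjTP; exists e; rewrite ?inE. Qed.

Lemma cut_comp p : cut (comp p) \subset M.
Proof.
apply/subsetP=> e; apply: contraLR => eM; have [u [v [_ E]]] := endsE e.
rewrite (cutE _ E); suff -> : (u \in comp p) = (v \in comp p) by rewrite addbb.
have vu := comp_edge eM E; have uv : u \in comp v by apply: (comp_edge eM); rewrite E setUC.
by apply/idP/idP => /comp_eq <-.
Qed.

Lemma edges_offM v : #|edges_at v :&: ~: M| = 2.
Proof. by have := cardsID M (edges_at v); rewrite matchM cubic setDE => -[]. Qed.

Lemma comp_gt1 p : 1 < #|comp p|.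
Proof.
have /card_gt0P[e] : 0 < #|edges_at p :&: ~: M| by rewrite edges_offM.
rewrite !inE => /andP[pe eM]; have [q qp E] := ends_other pe.
apply/card_gt1P; exists p, q; split; rewrite ?comp_id ?(comp_edge eM E) //.
by rewrite eq_sym.
Qed.

(** Components of [G] minus [M] have at least two vertices, so a three-element union of components
    is a single one. *)
Lemma matched_triangle_comp S p : matched_triangle S -> p \in S -> comp p = S.
Proof.
move=> [S3 SM _] pS.
have sub q : q \in S -> comp q \subset S.
  move=> qS; apply/subsetP=> r; rewrite inE => qr; apply: (connect_in _ qr) => // u v.
  move=> /sadjTP[e]; rewrite inE => eM E uS; apply: contraNT eM => vS.
  by apply: (subsetP SM); rewrite (cutE _ E) uS (negPf vS).
apply/eqP; rewrite eqEsubset sub //=; apply/subsetP=> r rS; apply/negPn/negP=> rp.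
have : #|comp p :|: comp r| <= #|S| by rewrite subset_leq_card // subUset !sub.
have dis : comp p :&: comp r = set0.
  apply/setP=> x; rewrite [in RHS]inE; apply/negP; rewrite inE => /andP[/comp_eq xp /comp_eq xr].
  by case/negP: rp; rewrite -xp xr comp_id.
by rewrite cardsU dis cards0 S3; have := comp_gt1 p; have := comp_gt1 r; lia.
Qed.

Definition cvert := {B : {set vert G} | [exists p, B == block p]}.

Lemma block_cvert p : [exists q, block p == block q].
Proof. by apply/existsP; exists p. Qed.

Definition cproj p : cvert := exist _ (block p) (block_cvert p).

Lemma cproj_surj (B : cvert) : exists p, cproj p = B.
Proof. by have /existsP[p /eqP E] := valP B; exists p; apply: val_inj. Qed.

Lemma cprojE p q : (cproj p == cproj q) = (q \in block p).
Proof.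
apply/eqP/idP => [[->]|qp]; first exact: block_id.
by apply: val_inj; rewrite /= (block_eq qp).
Qed.

(** Edges inside a block would become loops and are dropped. *)
Definition cedge := {e : edge G | #|cproj @: ends e| == 2}.

Definition contraction := @MGraph cvert cedge
  (fun e : cedge => cproj @: ends (val e)) (fun e : cedge => eqP (valP e)).

Local Notation G' := contraction.
Let f p : vert G' := cproj p.
Let ev (e : edge G') : edge G := val (e : cedge).

Lemma ev_inj : injective ev.
Proof. exact: val_inj. Qed.

Lemma cends (e : edge G') u v : ends (ev e) = [set u; v] -> ends e = [set f u; f v].
Proof.
move=> E; have -> : ends e = cproj @: ends (ev e) by [].
by rewrite E imsetU !imset_set1.
Qed.

Lemma cedgeP e u v : ends e = [set u; v] -> f u != f v -> exists e' : edge G', ev e' = e.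
Proof.
move=> E uv; have H : #|cproj @: ends e| == 2.
  by rewrite E imsetU !imset_set1 cards2 uv.
by exists (exist _ e H).
Qed.

Lemma cut_contraction (S : {set vert G'}) : cut (f @^-1: S) = ev @: cut S.
Proof.
apply/setP=> e; have [u [v [_ E]]] := endsE e.
rewrite (cutE _ E) !inE; apply/idP/imsetP => [uv|[e' + Ee]].
  have [|e' Ee] := cedgeP E; first by apply: contraTneq uv => ->; rewrite addbb.
  exists e' => //; rewrite -Ee in E; by rewrite (cutE _ (cends E)).
by rewrite Ee in E; rewrite (cutE _ (cends E)).
Qed.

Lemma card_cut_contraction (S : {set vert G'}) : #|cut S| = #|cut (f @^-1: S)|.
Proof. by rewrite cut_contraction card_imset //; apply: ev_inj. Qed.

Lemma preim_block p : f @^-1: [set f p] = block p.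
Proof. by apply/setP=> q; rewrite !inE eq_sym [LHS]cprojE. Qed.

Lemma card_cut_block p : #|cut (block p)| = 3.
Proof. by rewrite /block; case: ifP => [/andP[_ /eqP->]//|_]; rewrite cut1 cubic. Qed.

Lemma contraction_cubic : regular G' 3.
Proof.
move=> B; have [p <-] := cproj_surj B.
by rewrite -cut1 card_cut_contraction preim_block card_cut_block.
Qed.

(** * Cyclic edge connectivity of the contraction *)

Section SmallCuts.
Hypothesis small_cuts : forall S, S != set0 -> ~: S != set0 -> #|cut S| < 4 ->
  (#|S| = 1 \/ matched_triangle S) \/ (#|~: S| = 1 \/ matched_triangle (~: S)).

Lemma preim_neq0 (S : {set vert G'}) : S != set0 -> f @^-1: S != set0.
Proof.
by case/set0Pn=> B BS; have [p Ep] := cproj_surj B; apply/set0Pn; exists p; rewrite inE /f Ep.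
Qed.

Lemma small_preim (S : {set vert G'}) :
    #|f @^-1: S| = 1 \/ matched_triangle (f @^-1: S) ->
  #|S| <= 1 /\ #|cut S| = 3.
Proof.
have im : S = f @: (f @^-1: S).
  apply/setP=> B; apply/idP/imsetP => [BS|[p + ->]]; last by rewrite inE.
  by have [p Ep] := cproj_surj B; exists p; rewrite ?inE /f ?Ep.
rewrite card_cut_contraction; case=> [/eqP/cards1P[p Ep]|tri].
  by rewrite {1}im Ep imset_set1 cards1 cut1 cubic.
have [S3 SM cut3] := tri; split=> //; rewrite {1}im; apply/card_le1_eqP.
move=> _ _ /imsetP[p pS ->] /imsetP[q qS ->]; apply/eqP; rewrite [_ == _]cprojE.
by rewrite /block /contracted (matched_triangle_comp tri qS) S3 cut3.
Qed.

(** A cut of the contraction pulls back to a cut of [G] of the same size, one side of which is a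
    vertex or a matched triangle; either projects to one vertex. The exact size 3 rules out empty
    cuts and so gives connectedness. *)
Lemma contraction_essential (S : {set vert G'}) :
  S != set0 -> ~: S != set0 -> #|cut S| < 4 -> #|cut S| = 3 /\ (#|S| <= 1 \/ #|~: S| <= 1).
Proof.
move=> S0 S0' S4; have := @small_cuts (f @^-1: S).
rewrite -preimsetC -card_cut_contraction !preim_neq0 //.
case=> // /small_preim[]; first by move=> ? ?; split=> //; left.
by rewrite cutC; split=> //; right.
Qed.

Lemma contraction_cyclic4 : vert G -> cyclically_edge_connected G' 4.
Proof.
move=> v0; apply: cyclic4_intro.
  apply: connected_cut => [|S S0 S0']; first exact: f v0.
  apply/negP=> /eqP c0; have [] := contraction_essential S0 S0'.
    by rewrite c0 cards0.
  by rewrite c0 cards0.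
move=> S S1 S1'; rewrite leqNgt; apply/negP=> c4.
have S0 : S != set0 by rewrite -card_gt0 ltnW.
have S0' : ~: S != set0 by rewrite -card_gt0 ltnW.
by have [_ []] := contraction_essential S0 S0' c4; rewrite leqNgt ?S1 ?S1'.
Qed.
End SmallCuts.

(** * Lifting a dominating cycle through the triangles *)

Section Lift.
Variable s : seq (vert G' * edge G').
Hypothesis dom : dominating_cycle s.

Let F' := [set e in walk_edges s].
Let F0 := ev @: F'.
Let T0 := [set u | edges_at u :&: F0 != set0].
Let I := [set e | #|f @: ends e| != 2].
(* On a contracted triangle the cycle enters and leaves through two vertices
   and passes through the third, using the edges leaving T0. *)
Let F := F0 :|: (I :&: cut T0).

Lemma mem_I e u v : ends e = [set u; v] -> (e \in I) = (f u == f v).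
Proof.
move=> E; rewrite inE E imsetU !imset_set1 cards2.
by case: (f u == f v).
Qed.

Lemma F0_I : F0 :&: I = set0.
Proof.
apply/setP=> e; rewrite [RHS]inE; apply/negP; rewrite inE => /andP[/imsetP[e' _ ->]].
by rewrite inE (eqP (valP (e' : cedge))).
Qed.

Lemma block_degree0 p :
  #|cut (block p) :&: F0| = (f p \in walk_verts s).*2.
Proof.
have [ic _] := dom.
rewrite -preim_block cut_contraction cut1 -imsetI; last by move=> ? ? _ _; apply: ev_inj.
rewrite card_imset; last exact: ev_inj.
case: (boolP (f p \in _)) => [/(cycle_degree ic)//|/(cycle_degree0 ic)->].
by rewrite cards0.
Qed.

(** A set rather than a single edge, since parallel edges are only excluded by the count in
    [triangle]. *)
Definition link u v := [set e in ~: M | ends e == [set u; v]].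

Lemma linkC u v : link u v = link v u.
Proof. by rewrite /link setUC. Qed.

Lemma edges_link p q r : block p = [set p; q; r] -> contracted p ->
  edges_at p :&: ~: M = link p q :|: link p r.
Proof.
move=> B c; apply/setP=> e; rewrite !inE; apply/andP/orP => [[pe eM]|].
  have [w wp E] := ends_other pe; have : w \in block p.
    by rewrite /block c; apply: comp_edge eM E.
  by rewrite B !inE (negPf wp) /= => /orP[]/eqP<-; rewrite eM E eqxx; [left|right].
by case=> /andP[eM /eqP E]; rewrite E !inE eqxx.
Qed.

Lemma link_disjoint p q r : q != r -> p != q -> [disjoint link p q & link p r].
Proof.
move=> qr pq; rewrite -setI_eq0; apply/eqP/setP=> e; rewrite [RHS]inE; apply/negP.
rewrite !inE => /andP[/andP[_ /eqP E] /andP[_ /eqP E']].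
by move: qr; rewrite (ends_inj E E') eqxx.
Qed.

(** Each of the three vertices has two edges off [M], all inside the block. So the three
    multiplicities add up to 2 in pairs, and each equals 1. *)
Lemma triangle p q : contracted p -> q \in block p -> p != q -> exists r,
  [/\ block p = [set p; q; r], p != r, q != r &
      [/\ #|link p q| = 1, #|link p r| = 1 & #|link q r| = 1]].
Proof.
move=> c qB pq; have B3 : #|block p| = 3 by rewrite /block c; case/andP: c => /eqP.
have : #|(block p :\ p) :\ q| = 1.
  have := cardsD1 q (block p :\ p); have := cardsD1 p (block p).
  by rewrite B3 block_id !inE qB eq_sym pq /=; lia.
move=> /eqP/cards1P[r Er].
have [rq rp rB] : [/\ r != q, r != p & r \in block p].
  have : r \in (block p :\ p) :\ q by rewrite Er set11.
  by rewrite !inE => /and3P[].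
have B : block p = [set p; q; r].
  apply/esym/eqP; rewrite eqEcard B3 !subUset !sub1set block_id qB rB /=.
  by rewrite setUC cardsU1 !inE negb_or rp rq cards2 pq.
have conj x : x \in block p -> contracted x /\ block x = block p.
  by move=> xB; rewrite (block_eq xB) (contracted_eq xB).
have [cq Bq] := conj _ qB; have [cr Br] := conj _ rB.
have deg x y z : contracted x -> block x = [set x; y; z] -> y != z -> x != y ->
    #|link x y| + #|link x z| = 2.
  move=> cx Bx yz xy; rewrite -(edges_offM x) (edges_link Bx cx) cardsU.
  by rewrite (disjoint_setI0 (link_disjoint yz xy)) cards0 subn0.
have perm1 : block q = [set q; p; r] by rewrite Bq B (setUC [set q]).
have perm2 : block r = [set r; p; q] by rewrite Br B setUC setUA.
have pr : p != r by rewrite eq_sym.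
have qr : q != r by rewrite eq_sym.
have qp : q != p by rewrite eq_sym.
have := deg _ _ _ c B qr pq; have := deg _ _ _ cq perm1 pr qp.
have := deg _ _ _ cr perm2 pq rp; rewrite (linkC r p) (linkC r q) (linkC q p) => Er3 Eq3 Ep3.
by exists r; split=> //; split; lia.
Qed.

Lemma triangle_id p : contracted p -> exists2 q, q \in block p & p != q.
Proof.
move=> c; have := comp_gt1 p; rewrite /block c (cardsD1 p) comp_id ltnS.
by case/card_gt0P=> q; rewrite !inE eq_sym => /andP[? ?]; exists q; rewrite ?inE.
Qed.

Lemma inner_block_I p : inner (block p) \subset I.
Proof.
apply/subsetP=> e; have [u [v [_ E]]] := endsE e; rewrite (innerE _ E) (mem_I E).
by move=> /andP[/block_eq uB /block_eq vB]; rewrite [_ == _]cprojE uB -vB block_id.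
Qed.

(** The three vertices have one matching edge each and three matching edges leave the block, so none
    is left for the inside. *)
Lemma inner_block_M p : contracted p -> inner (block p) :&: M = set0.
Proof.
move=> c; have := handshake (block p) M.
rewrite (eq_bigr (fun=> 1)) => [|v _]; last exact: matchM.
have /setIidPl -> : cut (block p) \subset M by rewrite /block c cut_comp.
rewrite sum1_card card_cut_block {1}/block c; have /andP[/eqP-> _] := c.
by move=> Ec; apply/eqP; rewrite -cards_eq0; lia.
Qed.

(** Edges off [M] at a vertex of a contracted triangle stay inside it and are lost in the
    contraction, so only the matching edge at [v] can be in [F0]. *)
Lemma block_touched p : contracted p ->
  forall v, v \in block p -> #|edges_at v :&: F0| = (v \in T0).
Proof.
move=> c v vB; rewrite inE -card_gt0.
suff : #|edges_at v :&: F0| <= 1 by lia.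
rewrite -(matchM v) subset_leq_card //; apply/subsetP=> e; rewrite !inE => /andP[ve eF0].
rewrite ve /=; apply: contraT => eM; have [w _ E] := ends_other ve.
have : e \in F0 :&: I.
  rewrite inE eF0 (mem_I E) [_ == _]cprojE (block_eq vB) /block c.
  by move: vB; rewrite /block c => /comp_eq <-; apply: comp_edge E.
by rewrite F0_I inE.
Qed.

Lemma sum_touched p : contracted p ->
  \sum_(v in block p) (v \in T0) = (f p \in walk_verts s).*2.
Proof.
move=> c; rewrite -block_degree0 -(eq_bigr _ (block_touched c)) handshake.
suff -> : inner (block p) :&: F0 = set0 by rewrite cards0.
apply/eqP; rewrite -subset0 -F0_I setIC setIS //; exact: inner_block_I.
Qed.

Lemma sum_touched3 p q r : contracted p -> block p = [set p; q; r] -> p != q -> p != r -> q != r ->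
  (p \in T0) + (q \in T0) + (r \in T0) = (f p \in walk_verts s).*2.
Proof.
move=> c B pq pr qr; rewrite -sum_touched // B -setUA.
by rewrite !big_setU1 ?big_set1 ?inE ?negb_or ?pq ?pr ?qr //= addnA.
Qed.

Lemma link_cut u v : link u v :&: cut T0 = if (u \in T0) (+) (v \in T0) then link u v else set0.
Proof.
apply/setP=> e; rewrite in_setI; case: (boolP (e \in link u v)) => [eL|/negPf eL] /=.
  have := eL; rewrite inE => /andP[_ /eqP E].
  by rewrite (cutE _ E); case: ifP => _; rewrite ?eL ?in_set0.
by case: ifP => _; rewrite ?eL ?in_set0.
Qed.

(** In a visited triangle two vertices are touched by [F0]: each gains the link to the third vertex,
    which itself gets two links. An unvisited triangle gains nothing. *)
Lemma degree_lift p : #|edges_at p :&: F| = (f p \in walk_verts s).*2.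
Proof.
case: (boolP (contracted p)) => c; last first.
  have B : block p = [set p] by rewrite /block (negPf c).
  rewrite -block_degree0 B cut1 /F setIUr (_ : edges_at p :&: (_ :&: _) = set0) ?setU0 //.
  apply/setP=> e; rewrite [RHS]inE; apply/negP; rewrite !inE -/I => /andP[pe /andP[eI _]].
  have [w wp E] := ends_other pe; have := mem_I E.
  by rewrite !inE eI [_ == _]cprojE B inE (negPf wp).
have [q qB pq] := triangle_id c; have [r [B pr qr [L1 L2 L3]]] := triangle c qB pq.
have S3 := sum_touched3 c B pq pr qr.
have EI : edges_at p :&: I = edges_at p :&: ~: M.
  apply/setP=> e; rewrite !in_setI in_setC; case: (boolP (e \in edges_at p)) => //=.
  rewrite inE => pe; have [w _ E] := ends_other pe; rewrite (mem_I E) [_ == _]cprojE.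
  apply/idP/idP => [wB|eM]; last by rewrite /block c; apply: comp_edge E.
  apply/negP=> eM; have : e \in inner (block p) :&: M.
    by rewrite inE eM (innerE _ E) block_id wB.
  by rewrite inner_block_M // inE.
have dis : (edges_at p :&: F0) :&: (edges_at p :&: (I :&: cut T0)) = set0.
  apply/setP=> e; have /setP/(_ e) := F0_I; rewrite !in_setI in_set0.
  by case: (e \in F0); case: (e \in I); rewrite ?andbF.
rewrite /F setIUr cardsU dis cards0 subn0 (block_touched c (block_id p)).
rewrite setIA EI (edges_link B c) setIUl !link_cut cardsU.
rewrite (_ : _ :&: _ = set0); last first.
  have := disjoint_setI0 (link_disjoint qr pq).
  by case: ifP; case: ifP; rewrite ?setI0 ?set0I.
rewrite cards0 subn0 -S3.
have if_card (b : bool) (A : {set edge G}) : #|A| = 1 -> #|if b then A else set0| = b.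
  by case: b => //; rewrite cards0.
rewrite !if_card //.
(* For bits [a], [b], [c] of even sum, [a + (a xor b) + (a xor c)] equals [a + b + c]. *)
have : ~~ odd ((p \in T0) + (q \in T0) + (r \in T0)) by rewrite S3 odd_double.
by case: (p \in T0); case: (q \in T0); case: (r \in T0).
Qed.

Lemma link_step p q : #|link p q| = 1 -> contracted p -> q \in block p ->
  p \in T0 != (q \in T0) -> connect (sadj setT F) p q.
Proof.
move=> L c qB pq; have /card_gt0P[e] : 0 < #|link p q| by rewrite L.
rewrite inE => /andP[_ /eqP E]; apply: connect1; apply/sadjTP; exists e => //.
rewrite in_setU in_setI (mem_I E) (cutE _ E) [_ == _]cprojE qB -negb_eqb pq.
by rewrite orbT.
Qed.

(** A touched and an untouched vertex of the triangle are linked; two touched ones are joined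
    through the third vertex. *)
Lemma block_connected p q : f p = f q -> f p \in walk_verts s -> connect (sadj setT F) p q.
Proof.
move=> pq ps; have qB : q \in block p by rewrite -cprojE; apply/eqP.
have [<-|npq] := eqVneq p q; first exact: connect0.
have c : contracted p.
  by move: qB; rewrite /block; case: ifP => // _; rewrite inE eq_sym (negPf npq).
have [r [B pr qr [L1 L2 L3]]] := triangle c qB npq.
have := sum_touched3 c B npq pr qr; rewrite ps => S3.
have [|/negPn/eqP tpq] := boolP ((p \in T0) != (q \in T0)); first exact: link_step.
have rB : r \in block p by rewrite B !inE eqxx orbT.
have tr : (p \in T0) != (r \in T0).
  by move: S3; rewrite tpq; case: (q \in T0); case: (r \in T0).
apply: connect_trans (link_step L2 c rB tr) _; rewrite connect_sadjC.
apply: link_step => //; last by rewrite -tpq.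
  by rewrite (contracted_eq qB).
by rewrite (block_eq qB).
Qed.

Lemma lift_covered p : (edges_at p :&: F != set0) = (f p \in walk_verts s).
Proof. by rewrite -card_gt0 degree_lift; case: (_ \in _). Qed.

Lemma lift_connected p q : f p \in walk_verts s -> f q \in walk_verts s ->
  connect (sadj setT F) p q.
Proof.
move=> ps qs; have [ic _] := dom; have /and3P[_ ct _] := ic.
have cw : closed_walk s by case/andP: ct.
move: (ps) (qs) => /mapP[a sa Ea] /mapP[b sb Eb].
(* The invariant covers all vertices of the block, since the next cycle edge may leave from any of
   them. *)
pose A := [pred d : vert G' * edge G' | [forall x, (f x == d.1) ==> connect (sadj setT F) p x]].
suff /forallP/(_ q) : b \in A by rewrite Eb eqxx.
apply: (@cycle_in_next _ s A (closed_trail_uniq ct) _ a b) => //; last first.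
  by apply/forallP=> x; apply/implyP=> /eqP fx; apply: block_connected => //; rewrite fx.
move=> d sd /forallP pA; apply/forallP=> y; apply/implyP=> /eqP fy.
have [u [v [uv E]]] := endsE (ev d.2).
have eF : ev d.2 \in F by rewrite inE imset_f // inE walk_edges_in.
wlog [fu fv] : u v uv E / f u = d.1 /\ f v = (next s d).1.
  move=> W; have := closed_walk_next cw sd; rewrite (cends E) => Es.
  have uv' : f u != f v by apply: (@ends_neq _ d.2); apply: cends E.
  have : f u \in [set d.1; (next s d).1] by rewrite -Es !inE eqxx.
  have : f v \in [set d.1; (next s d).1] by rewrite -Es !inE eqxx orbT.
  rewrite !inE => /orP[]/eqP fv /orP[]/eqP fu; try by move: uv'; rewrite fu fv eqxx.
    by apply: (W v u) => //; rewrite 1?eq_sym // setUC.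
  exact: (W u v).
have pu : connect (sadj setT F) p u by apply: (implyP (pA u)); rewrite fu.
apply: connect_trans pu (connect_trans (connect1 _) _).
  by apply/sadjTP; exists (ev d.2); rewrite ?E.
by apply: block_connected; rewrite ?fv ?fy // walk_verts_in // mem_next.
Qed.

(** Matching edges survive the contraction, so the dominating cycle visits the block of one of their
    ends; the lift runs through all vertices of a visited block, hence through that end. *)
Lemma lift_cycle : exists c : seq (vert G * edge G), is_cycle c /\
  forall e, e \in M -> exists2 v, v \in ends e & v \in walk_verts c.
Proof.
have [ic dm] := dom; have [|v|u v|c [cc _ cF]] := @two_regular_cycle G F.
- have [a sa] : exists a, a \in s.
    by case/and3P: ic; case: (s) => // d t _ _ _; exists d; rewrite inE eqxx.
  by apply/set0Pn; exists (ev a.2); rewrite inE imset_f // inE walk_edges_in.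
- by rewrite degree_lift; case: (_ \in _); [right|left].
- by rewrite !lift_covered; apply: lift_connected.
exists c; split=> // e eM; have [u [v [uv E]]] := endsE e.
have fuv : f u != f v.
  apply/negP; rewrite [_ == _]cprojE => vB; have [c'|c'] := boolP (contracted u).
    have : e \in inner (block u) :&: M by rewrite inE eM (innerE _ E) block_id vB.
    by rewrite inner_block_M // inE.
  by move: vB; rewrite /block (negPf c') inE eq_sym (negPf uv).
have [e' Ee] := cedgeP E fuv; have [B Be Bs] := dm e'.
move: Be; rewrite -Ee in E; rewrite (cends E) !inE -Ee E => /orP[]/eqP EB.
  by exists u; rewrite ?inE ?eqxx //; apply: cF; rewrite lift_covered -EB.
by exists v; rewrite ?inE ?eqxx ?orbT //; apply: cF; rewrite lift_covered -EB.
Qed.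

End Lift.
End Contraction.

Lemma matching_cycle (G : mgraph) (M : {set edge G}) :
    (forall G' : mgraph, regular G' 3 -> cyclically_edge_connected G' 4 ->
      exists s : seq (vert G' * edge G'), dominating_cycle s) ->
    regular G 3 -> (forall v : vert G, #|edges_at v :&: M| = 1) -> vert G ->
    (forall S : {set vert G}, S != set0 -> ~: S != set0 -> #|cut S| < 4 ->
      (#|S| = 1 \/ matched_triangle M S) \/ (#|~: S| = 1 \/ matched_triangle M (~: S))) ->
  exists c : seq (vert G * edge G), is_cycle c /\
    forall e, e \in M -> exists2 v, v \in ends e & v \in walk_verts c.
Proof.
move=> dcc cubic matchM v0 small.
have [s] := dcc _ (@contraction_cubic G cubic M) (contraction_cyclic4 cubic matchM small v0).
exact: lift_cycle.
Qed.

(** * Splitting the vertices of a 4-regular graph *)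

Section Walks.
Variable G : mgraph.

(** With both ends explicit, the darts on new edges can be erased by induction, as in [walk_old]. *)
Fixpoint walk (v : vert G) (s : seq (vert G * edge G)) (w : vert G) : Prop :=
  if s is d :: t then d.1 = v /\ exists2 u, ends d.2 = [set v; u] & walk u t w
  else v = w.

Lemma closed_walkP d s : closed_walk (d :: s) <-> walk d.1 (d :: s) d.1.
Proof.
(* The closing dart [x] is detached from the first dart, so that the induction can move the
   latter. *)
rewrite /closed_walk /cycle; move: {2 5}d => x.
elim: s d => [|d' s IH] d /=.
  rewrite andbT; split=> [/eqP E|[_ [u E ux]]]; last by rewrite E ux.
  by split=> //; exists x.1.
split=> [/andP[/eqP E /IH]|[_ [u E ux]]]; first by split=> //; exists d'.1.
have Ed : d'.1 = u by case: ux.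
by rewrite Ed E eqxx; apply/IH; rewrite Ed.
Qed.

End Walks.

Section FourConnected.
Variable H : mgraph.
Hypothesis reg4 : regular H 4.
Hypothesis con4 : k_connected H 4.

(** If both sides had a vertex outside [Z], a path avoiding [Z] would join these two and cross
    [cut A] at an edge that misses [Z]. *)
Lemma separator (Z A : {set vert H}) : #|Z| < 4 ->
    (forall e, e \in cut A -> exists2 z, z \in Z & z \in ends e) ->
  A \subset Z \/ ~: A \subset Z.
Proof.
move=> Z4 cov; have [/subsetP|/subsetPn[u uA uZ]] := boolP (A \subset Z); first by left.
have [/subsetP|/subsetPn[v vA vZ]] := boolP (~: A \subset Z); first by right.
have [_ /(_ Z Z4)[_ /(_ u v)]] := con4; rewrite !inE uZ vZ => /(_ isT isT) uv.
suff : v \in A by move: vA; rewrite inE => /negPf->.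
apply: (connect_in _ uv) => // x y /and3P[]; rewrite !inE => xZ yZ /existsP[e /andP[_ /eqP E]] xA.
apply/negPn/negP => yA; have [|z zZ] := cov e; first by rewrite (cutE _ E) xA (negPf yA).
by rewrite E !inE => /orP[]/eqP zE; move: zZ; rewrite zE ?(negPf xZ) ?(negPf yZ).
Qed.

(** With two parallel edges at [u], at most three neighbours would separate [u] from the remaining
    vertices, and [H] has at least five vertices. *)
Lemma no_parallel (e f : edge H) : ends e = ends f -> e = f.
Proof.
move=> Eef; apply/eqP/negPn/negP => ef; have [u [v [uv E]]] := endsE e.
pose o g := odflt u [pick w | (w != u) && (ends g == [set u; w])].
have oE g w : ends g = [set u; w] -> o g = w.
  move=> Eg; rewrite /o; case: pickP => [x /andP[_ /eqP Ex]|/(_ w)].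
    exact: ends_inj Ex Eg.
  by rewrite Eg eqxx andbT eq_sym (ends_neq Eg).
pose N := o @: (edges_at u :\ f).
have N4 : #|N| < 4.
  apply: leq_ltn_trans (leq_imset_card _ _) _.
  by have := cardsD1 f (edges_at u); rewrite reg4 inE -Eef E !inE eqxx add1n => -[<-].
have ngh g w : ends g = [set u; w] -> w \in N.
  move=> Eg; have [gf|gf] := eqVneq g f; last first.
    by apply/imsetP; exists g; rewrite ?(oE _ _ Eg) // !inE gf Eg !inE eqxx.
  apply/imsetP; exists e; rewrite ?inE ?ef ?E ?inE ?eqxx //.
  by rewrite (oE _ v E); apply: (ends_inj Eg); rewrite gf -Eef.
have uN : u \notin N.
  apply/imsetP=> -[g]; rewrite !inE => /andP[_ ug]; have [w wu Eg] := ends_other ug.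
  by rewrite (oE _ _ Eg) => uw; move: wu; rewrite uw eqxx.
have [] := @separator N [set u] N4.
- rewrite cut1 => g; rewrite inE => ug; have [w _ Eg] := ends_other ug.
  by exists w; [apply: ngh Eg|rewrite Eg !inE eqxx orbT].
- by rewrite sub1set (negPf uN).
move=> /subset_leq_card; have := cardsC [set u]; rewrite cards1.
by case: con4; lia.
Qed.

Variable T : vert H -> {set {set edge H}}.
Hypothesis hT : transition_system T.

Lemma transition_card v : #|T v| = 2.
Proof.
have [pT c2] := hT v; have := card_uniform_partition c2 pT; rewrite reg4.
by lia.
Qed.

Lemma transition_sub v P e : P \in T v -> e \in P -> v \in ends e.
Proof.
have [/and3P[/eqP cov _ _] _] := hT v => PT eP.
have : e \in edges_at v by rewrite -cov; apply/bigcupP; exists P.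
by rewrite inE.
Qed.

Lemma transition_at v e : v \in ends e -> exists2 P, P \in T v & e \in P.
Proof.
have [/and3P[/eqP cov _ _] _] := hT v => ve.
have : e \in cover (T v) by rewrite cov inE.
by case/bigcupP=> P PT eP; exists P.
Qed.

Lemma transition_inj v P Q e : P \in T v -> Q \in T v -> e \in P -> e \in Q -> P = Q.
Proof.
have [/and3P[_ /trivIsetP tI _] _] := hT v => PT QT eP eQ.
apply/eqP/negPn/negP=> /(tI _ _ PT QT); rewrite -setI_eq0 => /eqP/setP/(_ e).
by rewrite !inE eP eQ.
Qed.

(** The vertex is stored with the transition because two parallel edges could form a transition at
    both of their ends. *)
Definition half := {p : vert H * {set edge H} | p.2 \in T p.1}.
Definition hv (p : half) : vert H := (val p).1.
Definition ht (p : half) : {set edge H} := (val p).2.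

Lemma half_eq p q : hv p = hv q -> ht p = ht q -> p = q.
Proof.
case: p => -[v P] hp; case: q => -[w Q] hq; rewrite /hv /ht /= => E1 E2.
by apply: val_inj; rewrite /= E1 E2.
Qed.

Lemma htP p : ht p \in T (hv p).
Proof. exact: (valP p). Qed.

Definition split_ends (x : edge H + vert H) : {set half} :=
  match x with
  | inl e => [set p | e \in ht p]
  | inr v => [set p | hv p == v]
  end.

Lemma split_ends_l e : hv @: split_ends (inl e) = ends e.
Proof.
apply/setP=> v; apply/imsetP/idP => [[p]|ve].
  by rewrite inE => ep ->; apply: transition_sub (htP p) ep.
by have [P PT eP] := transition_at ve; exists (exist _ (v, P) PT); rewrite ?inE.
Qed.

Lemma card_split_ends x : #|split_ends x| = 2.
Proof.
case: x => [e|v].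
  rewrite -(card_ends e) -split_ends_l card_in_imset // => p q.
  rewrite !inE => ep eq E; apply: half_eq => //; apply: (transition_inj (htP p)) ep eq.
  by rewrite E htP.
rewrite -(transition_card v) -(card_in_imset (f := ht)) => [|p q].
  apply: eq_card => P; apply/imsetP/idP => [[p]|PT].
    by rewrite inE => /eqP<- ->; apply: htP.
  by exists (exist _ (v, P) PT); rewrite ?inE.
by rewrite !inE => /eqP pv /eqP qv; apply: half_eq; rewrite pv.
Qed.

(* Vertices are the transitions; [inl e] is an edge of H and [inr v] the new
   edge joining the two transitions at v. *)
Definition split_graph := @MGraph half (edge H + vert H)%type split_ends card_split_ends.

Local Notation G := split_graph.

Lemma ends_l (e : edge H) (p : vert G) : (p \in ends (inl e : edge G)) = (e \in ht p).
Proof. by rewrite inE. Qed.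

Lemma ends_r (v : vert H) (p : vert G) : (p \in ends (inr v : edge G)) = (hv p == v).
Proof. by rewrite inE. Qed.

Lemma split_ends_lE (e : edge H) (p q : vert G) :
  ends (inl e : edge G) = [set p; q] -> ends e = [set hv p; hv q].
Proof.
move=> E; rewrite -split_ends_l.
have -> : split_ends (inl e) = [set p; q] by rewrite -E.
by rewrite imsetU !imset_set1.
Qed.

Lemma split_edges_at (p : vert G) :
  edges_at p = (inr (hv p) : edge G) |: [set inl e | e in ht p].
Proof.
apply/setP=> -[e|v]; rewrite [LHS]inE ?ends_l ?ends_r !inE /=.
  by rewrite mem_imset // => x y [].
rewrite (inj_eq (@inr_inj _ _)) eq_sym; case: eqP => //= _.
by apply/esym/negP => /imsetP[].
Qed.

Lemma split_cubic : regular G 3.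
Proof.
move=> p; rewrite split_edges_at cardsU1 card_imset; last by move=> ? ? [].
have [_ /(_ (ht p) (htP p)) ->] := hT (hv p).
by rewrite (_ : _ \notin _) //; apply/imsetP => -[].
Qed.

Definition split_matching : {set edge G} := [set inr v | v : vert H].
Local Notation M := split_matching.

Lemma mem_split_matching (x : edge G) : (x \in M) = if x is inr _ then true else false.
Proof. by apply/imsetP/idP => [[v _ ->]|] //; case: x => // v _; exists v. Qed.

Lemma matching_degree (p : vert G) : #|edges_at p :&: M| = 1.
Proof.
rewrite (_ : _ :&: _ = [set (inr (hv p) : edge G)]) ?cards1 //.
apply/setP=> x; rewrite split_edges_at !inE mem_split_matching.
by case: x => [e|v]; rewrite ?andbF //= andbT; case: imsetP => [[]|] //; rewrite orbF.
Qed.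

(** * Small edge cuts of the split graph *)

Implicit Types (S : {set vert G}) (Z : {set vert H}).

(** In [H], [cut S] becomes a mixed cut, made of the vertices [halved S] and the edges [crossing S],
    between [whole S] and [whole (~: S)]. *)
Let whole (S : {set vert G}) : {set vert H} := [set v | (inr v : edge G) \in inner S].
Let halved (S : {set vert G}) : {set vert H} := [set v | (inr v : edge G) \in cut S].
Let crossing (S : {set vert G}) : {set edge H} := [set e | (inl e : edge G) \in cut S].

Lemma card_inr (X : {set edge G}) : #|X :&: M| = #|[set v | (inr v : edge G) \in X]|.
Proof.
rewrite -[RHS](card_imset _ (@inr_inj (edge H) (vert H))); apply: eq_card => x.
rewrite inE mem_split_matching; apply/andP/imsetP => [|[v + ->]]; last by rewrite inE.
by case: x => [e|v] [] // xX _; exists v; rewrite ?inE.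
Qed.

Lemma card_cut_split S : #|cut S| = #|halved S| + #|crossing S|.
Proof.
rewrite -(cardsID M (cut S)) card_inr; congr (_ + _).
rewrite -[RHS](card_imset _ (@inl_inj (edge H) (vert H))); apply: eq_card => x.
rewrite in_setD mem_split_matching; apply/andP/imsetP => [|[v + ->]]; last by rewrite inE.
by case: x => [e|v] [] // _ xX; exists e => //; rewrite inE.
Qed.

Lemma card_split_set S : #|S| = #|whole S|.*2 + #|halved S|.
Proof.
have := handshake S M; rewrite (eq_bigr (fun=> 1)) => [|p _]; last exact: matching_degree.
by rewrite sum1_card !card_inr.
Qed.

(** Modulo 2, [#|S|] agrees with [#|cut S|], the graph being cubic, and with [#|halved S|], the new
    edges being a perfect matching. *)
Lemma crossing_even S : ~~ odd #|crossing S|.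
Proof.
have := cubic_handshake split_cubic S; rewrite card_cut_split (card_split_set S) => E.
have : odd ((#|whole S|.*2 + #|halved S|) * 3) =
       odd (#|inner S|.*2 + (#|halved S| + #|crossing S|)) by rewrite E.
by rewrite oddM !oddD !odd_double /= andbT; case: (odd #|halved S|); case: (odd #|crossing S|).
Qed.

Lemma split_ends_rE (v : vert H) (p q : vert G) :
  ends (inr v : edge G) = [set p; q] -> hv p = v /\ hv q = v.
Proof.
by move=> E; split; apply/eqP; rewrite -ends_r E !inE eqxx ?orbT.
Qed.

Lemma in_whole S v p q : ends (inr v : edge G) = [set p; q] ->
  (v \in whole S) = (p \in S) && (q \in S).
Proof. by move=> E; rewrite [LHS]in_set (innerE _ E). Qed.

Lemma in_halved S v p q : ends (inr v : edge G) = [set p; q] ->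
  (v \in halved S) = (p \in S) (+) (q \in S).
Proof. by move=> E; rewrite [LHS]in_set (cutE _ E). Qed.

Lemma in_crossing S e p q : ends (inl e : edge G) = [set p; q] ->
  (e \in crossing S) = (p \in S) (+) (q \in S).
Proof. by move=> E; rewrite [LHS]in_set (cutE _ E). Qed.

Lemma split_class S (p : vert G) :
  (hv p \in whole S -> p \in S) /\
  (p \in S -> hv p \notin whole S -> hv p \in halved S).
Proof.
have [|q _ E] := @ends_other G (inr (hv p)) p; first by rewrite ends_r.
rewrite (in_whole _ E) (in_halved _ E); split=> [/andP[]//|pS].
by rewrite pS.
Qed.

Lemma whole_cases S v : [|| v \in whole S, v \in whole (~: S) | v \in halved S].
Proof.
have [p [q [_ E]]] := @endsE G (inr v).
by rewrite !(in_whole _ E) (in_halved _ E) !in_setC; case: (p \in S); case: (q \in S).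
Qed.

Lemma halvedC S : halved (~: S) = halved S.
Proof. by rewrite /halved cutC. Qed.

Lemma whole_disjoint S v : v \in whole S -> (v \notin whole (~: S)) && (v \notin halved S).
Proof.
have [p [q [_ E]]] := @endsE G (inr v).
by rewrite !(in_whole _ E) (in_halved _ E) !in_setC => /andP[-> ->].
Qed.

Lemma crossing_ends S e : e \in crossing S -> exists x y, [/\ ends e = [set x; y],
  x \notin whole (~: S) & y \notin whole S].
Proof.
have [p [q [_ E]]] := @endsE G (inl e).
wlog pS : p q E / p \in S.
  move=> W; rewrite (in_crossing _ E); have [pS|pS] := boolP (p \in S).
    by move=> H0; apply: (W p q) => //; rewrite (in_crossing _ E) pS.
  move=> /= qS; apply: (W q p) => //; first by rewrite E setUC.
  by rewrite (in_crossing _ E) (negPf pS).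
rewrite (in_crossing _ E) pS /= => qS; exists (hv p), (hv q); split.
- exact: split_ends_lE.
- by apply/negP=> /(split_class _ _).1; rewrite in_setC pS.
- by apply/negP=> /(split_class _ _).1; apply/negP.
Qed.

Lemma split_separator S Z : #|Z| < 4 -> halved S \subset Z ->
    (forall e, e \in crossing S -> exists2 z, z \in Z & z \in ends e) ->
  whole S \subset Z \/ whole (~: S) \subset Z.
Proof.
move=> Z4 CZ cov.
have side e x y : ends e = [set x; y] -> x \in whole S -> y \notin whole S ->
    exists2 z, z \in Z & z \in ends e.
  move=> E xA yA; have [yC|yC] := boolP (y \in halved S).
    by exists y; [apply: (subsetP CZ)|rewrite E !inE eqxx orbT].
  apply: cov; have [p [q [_ Epq]]] := @endsE G (inl e).
  have Es := split_ends_lE Epq; rewrite (in_crossing _ Epq).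
  have yS r : hv r = y -> r \notin S.
    move=> ry; apply/negP => rS; case/negP: yC; rewrite -ry.
    by apply: (split_class _ _).2; rewrite ?ry.
  have xS r : hv r = x -> r \in S by move=> rx; apply: (split_class _ _).1; rewrite rx.
  have xy := ends_neq E.
  have : x \in [set hv p; hv q] by rewrite -Es E !inE eqxx.
  have : y \in [set hv p; hv q] by rewrite -Es E !inE eqxx orbT.
  rewrite !inE => /orP[]/eqP Ey /orP[]/eqP Ex; try by move: xy; rewrite Ex Ey eqxx.
    by rewrite (xS q) // (negPf (yS p _)).
  by rewrite (xS p) // (negPf (yS q _)).
have [|e|->|sub] := @separator Z (whole S) => //; [|by left|right].
  have [x [y [_ E]]] := endsE e; rewrite (cutE _ E).
  case: (boolP (x \in whole S)) => [xA /= yA|xA /= yA]; first exact: side E xA yA.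
  by apply: (side e y x) => //; rewrite E setUC.
apply: subset_trans sub; apply/subsetP=> v; rewrite in_setC => vB.
apply/negP=> /whole_disjoint/andP[]; by rewrite vB.
Qed.

Lemma vert_cover S : 4 < #|whole S| + #|whole (~: S)| + #|halved S|.
Proof.
apply: (@leq_trans #|vert H|); first by case: con4.
have -> : #|vert H| = #|whole S :|: whole (~: S) :|: halved S|.
  by rewrite -cardsT; apply: eq_card => v; rewrite !in_setU -orbA whole_cases in_setT.
by apply: leq_trans (leq_card_setU _ _) _; rewrite leq_add2r leq_card_setU.
Qed.

Lemma whole_halved S A : whole S \subset halved S :|: A -> whole S \subset A.
Proof.
move=> /subsetP sub; apply/subsetP=> v vS; have := sub _ vS.
by have /andP[_ /negPf] := whole_disjoint vS; rewrite in_setU => ->.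
Qed.

Lemma whole_set1 S x y : whole S \subset [set x; y] -> y \notin whole S -> #|whole S| <= 1.
Proof.
move=> /subsetP sub yS; rewrite -(cards1 x) subset_leq_card //.
apply/subsetP=> v vS; have := sub v vS; rewrite !inE => /orP[//|/eqP vy].
by move: yS; rewrite -vy vS.
Qed.

(** Without crossing edges, the halved vertices alone separate. With two, at most one vertex is
    halved, and adding an end of each crossing edge gives a separator of size at most 3 for every
    choice of the ends. Choosing both ends on the same side either finishes the proof or bounds
    [whole] on that side by 2. *)
Lemma no_whole S : #|cut S| < 4 -> whole S = set0 \/ whole (~: S) = set0.
Proof.
rewrite card_cut_split => lt4; have := crossing_even S.
have [D0 _|D0 ev] := eqVneq #|crossing S| 0.
  have [|e|W|W] := @split_separator S (halved S) _ (subxx _).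
  - by rewrite D0 addn0 in lt4.
  - by move/eqP: D0; rewrite cards_eq0 => /eqP->; rewrite inE.
  - by left; apply/eqP; rewrite -subset0; apply: whole_halved; rewrite setU0.
  - by right; apply/eqP; rewrite -subset0; apply: whole_halved; rewrite setU0 halvedC.
have D2 : #|crossing S| = 2 by case: #|crossing S| ev D0 lt4 => [|[|[|[|]]]] //; lia.
have /cards2P[e1 [e2 [_ De]]] : #|crossing S| == 2 by rewrite D2.
have [|x1 [y1 [E1 x1S y1S]]] := @crossing_ends S e1; first by rewrite De !inE eqxx.
have [|x2 [y2 [E2 x2S y2S]]] := @crossing_ends S e2; first by rewrite De !inE eqxx orbT.
have key z1 z2 : z1 \in ends e1 -> z2 \in ends e2 ->
    whole S \subset [set z1; z2] \/ whole (~: S) \subset [set z1; z2].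
  move=> ze1 ze2; have [||e|/whole_halved|] := @split_separator S (halved S :|: [set z1; z2]).
  - apply: leq_ltn_trans (leq_card_setU _ _) _.
    by have : #|[set z1; z2]| <= 2; [rewrite cards2; case: (_ != _)|lia].
  - exact: subsetUl.
  - rewrite De !inE => /orP[]/eqP->; [exists z1|exists z2] => //;
    by rewrite !inE eqxx ?orbT.
  - by left.
  - by rewrite -halvedC => /whole_halved; right.
have xe1 : x1 \in ends e1 by rewrite E1 !inE eqxx.
have ye1 : y1 \in ends e1 by rewrite E1 !inE eqxx orbT.
have xe2 : x2 \in ends e2 by rewrite E2 !inE eqxx.
have ye2 : y2 \in ends e2 by rewrite E2 !inE eqxx orbT.
have card2 (A : {set vert H}) z1 z2 : A \subset [set z1; z2] -> #|A| <= 2.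
  by move=> /subset_leq_card/leq_trans; apply; rewrite cards2; case: (_ != _).
have empty S' z1 z2 : whole S' \subset [set z1; z2] -> z1 \notin whole S' ->
    z2 \notin whole S' -> whole S' = set0.
  move=> /subsetP sub n1 n2; apply/setP=> v; rewrite [RHS]inE; apply/negP=> vS.
  by have := sub v vS; rewrite !inE => /orP[]/eqP vz; [move: n1|move: n2]; rewrite -vz vS.
have := vert_cover S.
have [A2|/empty A0] := key _ _ xe1 xe2; last by right; apply: A0.
have [/empty A0|B2] := key _ _ ye1 ye2; first by left; apply: A0.
have := card2 _ _ _ A2; have := card2 _ _ _ B2.
(* Ends on opposite sides lower one of the two bounds to 1, so [H] would have at most 1 + 2 + 1
   vertices. *)
have [A1|B1] := key _ _ xe1 ye2.
  by have := whole_set1 A1 y2S; lia.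
by rewrite setUC in B1; have := whole_set1 B1 x1S; lia.
Qed.

(** Every vertex of [S] now sends its new edge into the cut, so [#|cut S|] is [#|S|] plus an even
    number. If [S] has at least two vertices, this number is 0; two vertices would be joined by two
    edges of [H], which [no_parallel] forbids, and three form a matched triangle. *)
Lemma tiny_side S : S != set0 -> #|cut S| < 4 -> whole S = set0 ->
  #|S| = 1 \/ matched_triangle M S.
Proof.
move=> S0 lt4 W0; have := card_split_set S; rewrite W0 cards0 add0n => SC.
have := crossing_even S; move: lt4; rewrite card_cut_split -SC.
move: S0; rewrite -card_gt0.
have [S1|S1] := eqVneq #|S| 1; first by left.
move=> gt0 lt4 ev; have D0 : #|crossing S| = 0.
  by case: #|crossing S| ev lt4 => [|[|]] //; lia.
have cM : cut S \subset M.
  apply/subsetP=> -[e|v] ec; rewrite mem_split_matching //.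
  have : e \in crossing S by rewrite in_set.
  by move/eqP: D0; rewrite cards_eq0 => /eqP->; rewrite inE.
have [S3|S3] := eqVneq #|S| 3.
  by right; split=> //; rewrite card_cut_split -SC S3 D0.
have /cards2P[p [q [pq E]]] : #|S| == 2 by lia.
have /cards2P[e [f [ef Ep]]] : #|ht p| == 2.
  by have [_ /(_ (ht p) (htP p)) ->] := hT (hv p).
have par g : g \in ht p -> ends g = [set hv p; hv q].
  move=> gp; have [|r rp Er] := @ends_other G (inl g) p; first by rewrite ends_l.
  rewrite (split_ends_lE Er); suff -> : r = q by [].
  have : (inl g : edge G) \notin cut S.
    by apply/negP=> /(subsetP cM); rewrite mem_split_matching.
  by rewrite (cutE _ Er) E !inE eqxx (negPf rp) /= negbK => /eqP.
by case/eqP: ef; apply: no_parallel; rewrite !par // Ep !inE eqxx ?orbT.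
Qed.

Lemma split_small_cuts S : S != set0 -> ~: S != set0 -> #|cut S| < 4 ->
  (#|S| = 1 \/ matched_triangle M S) \/ (#|~: S| = 1 \/ matched_triangle M (~: S)).
Proof.
move=> S0 S0' lt4; case: (no_whole lt4) => W; [left|right]; apply: tiny_side => //.
by rewrite cutC.
Qed.

(** * From a cycle of the split graph to a trail *)

Section FromCycle.
Variable c : seq (vert G * edge G).
Hypothesis cycle_c : is_cycle c.
Hypothesis hit : forall e, e \in M -> exists2 p, p \in ends e & p \in walk_verts c.

Definition old_dart (d : vert G * edge G) : option (vert H * edge H) :=
  if d.2 is inl e then Some (hv d.1, e) else None.

Let s := pmap old_dart c.
Let Fc := [set x in walk_edges c].
Let K := [set e | (inl e : edge G) \in Fc].

(** Both ends of a new edge lie over the same vertex of [H], so erasing its dart does not break the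
    walk. *)
Lemma walk_old t (p q : vert G) : walk p t q -> walk (hv p) (pmap old_dart t) (hv q).
Proof.
elim: t p => [|[a x] t IH] p /=; first by move=> ->.
case=> -> [u]; case: x => [e|v] /= E /IH w.
  by split=> //; exists (hv u) => //; apply: split_ends_lE.
by have [-> Eu] := split_ends_rE E; rewrite -Eu.
Qed.

Lemma mem_old_edges e : (e \in walk_edges s) = (e \in K).
Proof.
rewrite !in_set; apply/mapP/mapP => [[d]|[[a x] ds /= xe]].
  rewrite mem_pmap => /mapP[[a [f|v]] ds] //= [->] ->.
  by exists (a, inl f).
by exists (hv a, e) => //; rewrite mem_pmap; apply/mapP; exists (a, x) => //; rewrite -xe.
Qed.

Lemma old_uniq : uniq (walk_edges s).
Proof.
have /and3P[_ /andP[_ U] _] := cycle_c.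
pose g (x : edge G) : option (edge H) := if x is inl e then Some e else None.
have -> : walk_edges s = pmap g (walk_edges c).
  by rewrite /s; elim: c => [|[a [e|v]] t /= ->].
apply: (pmap_uniq (g := inl)) U => -[e|v] //.
Qed.

Lemma old_closed_walk : closed_walk s.
Proof.
have /and3P[_ /andP[cw _] _] := cycle_c.
rewrite /s; case: (c) cw => // d t /closed_walkP/walk_old.
case: (pmap _ _) => // a u w; apply/closed_walkP.
by have -> : a.1 = hv d.1 by case: w.
Qed.

Lemma old_degree (p : vert G) :
  #|ht p :&: K| + ((inr (hv p) : edge G) \in Fc) = (p \in walk_verts c).*2.
Proof.
transitivity #|edges_at p :&: Fc|; last first.
  case: (boolP (p \in _)) => [/(cycle_degree cycle_c)//|/(cycle_degree0 cycle_c)->].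
  by rewrite cards0.
have sumI (A : finType) (X Y : {set A}) : #|X :&: Y| = \sum_(x in X) (x \in Y).
  by rewrite -sum1_card -big_mkcondr; apply: eq_bigl => x; rewrite inE.
rewrite !sumI split_edges_at big_setU1 /=; last by apply/imsetP=> -[].
rewrite addnC big_imset /=; last by move=> ? ? _ _ [].
by congr (_ + _); apply: eq_bigr => e _; rewrite [in LHS]inE.
Qed.

(** A cycle through [r] that avoids the new edge at [r] traverses the two edges of the transition
    [ht r] one after the other. *)
Lemma old_follows (r : vert G) : r \in walk_verts c -> (inr (hv r) : edge G) \notin Fc ->
  follows s (ht r).
Proof.
move=> /mapP[d' cd' ->] {r}; set r := d'.1 => nM.
have /and3P[_ ct _] := cycle_c; have Uc := closed_trail_uniq ct.
pose d := prev c d'; have cd : d \in c by rewrite mem_prev.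
have nd : next c d = d' by rewrite next_prev.
have dd' : d.2 != d'.2 by apply: trail_prev_neq.
have Er := cycle_edges_at cycle_c cd'; rewrite -/d in Er.
have old x : x \in [set d.2; d'.2] -> exists2 e, x = inl e & e \in ht r.
  rewrite -Er in_setI; case: x => [e|v] /andP[].
    by rewrite [_ \in edges_at _]in_set ends_l => er _; exists e.
  by rewrite [_ \in edges_at _]in_set ends_r => /eqP<- vF; rewrite vF in nM.
have [|f Ef fr] := old d.2; first by rewrite !inE eqxx.
have [|g Eg gr] := old d'.2; first by rewrite !inE eqxx orbT.
have fg : f != g by apply: contraNneq dd' => fg; rewrite Ef Eg fg.
have Ht : ht r = [set f; g].
  apply/esym/eqP; rewrite eqEcard subUset !sub1set fr gr cards2 fg.
  by have [_ /(_ (ht r) (htP r)) ->] := hT (hv r).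
(* Erasing darts does not commute with [next]; rotating both darts to the front keeps them adjacent
   after the erasure. *)
have [i t Et] := rot_to cd.
have [t' Et'] : exists t', t = d' :: t'.
  move: nd; rewrite -(next_rot i Uc) Et; case: t {Et} => [|x t'] /=; rewrite eqxx => E.
    by move: dd'; rewrite E eqxx.
  by exists t'; rewrite E.
pose a : vert H * edge H := (hv d.1, f); pose b : vert H * edge H := (hv d'.1, g).
have [j Ej] : exists j, rot j s = [:: a, b & pmap old_dart t'].
  (* The number of darts that survive among those in front of [d]. *)
  exists (size (pmap old_dart (take i c))).
  rewrite /s -{2}(cat_take_drop i c) pmap_cat rot_size_cat -pmap_cat -/(rot i c) Et Et'.
  by rewrite /= /old_dart Ef Eg.
exists a; first by rewrite -(mem_rot j) Ej mem_head.
by rewrite -(next_rot j (map_uniq old_uniq)) Ej /= eqxx Ht.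
Qed.

(** If the cycle uses the new edge at [v], each half of [v] contributes one old edge. Otherwise a
    half on the cycle contributes its whole transition: one such half gives two edges, and two
    halves give both transitions. By [hit] there is at least one. *)
Lemma trail_of_cycle : T_hamiltonian T.
Proof.
exists s; have cw := old_closed_walk.
have kdeg v : exists p q : vert G, [/\ ends (inr v : edge G) = [set p; q], hv p = v, hv q = v &
    #|edges_at v :&: K| = #|ht p :&: K| + #|ht q :&: K|].
  have [p [q [pq E]]] := @endsE G (inr v); have [pv qv] := split_ends_rE E.
  exists p, q; split=> //; have -> : edges_at v = ht p :|: ht q.
    apply/setP=> e; rewrite inE in_setU; apply/idP/orP => [ve|]; last first.
      by case=> /(transition_sub (htP _)); rewrite ?pv ?qv.
    have [R RT eR] := transition_at ve; pose r : vert G := exist _ (v, R) RT.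
    have : r \in ends (inr v : edge G) by rewrite ends_r.
    by rewrite E !inE => /orP[]/eqP Er; [left|right]; rewrite -Er.
  rewrite setIUl cardsU; suff -> : ht p :&: K :&: (ht q :&: K) = set0 by rewrite cards0 subn0.
  apply/setP=> e; rewrite [RHS]inE; apply/negP; rewrite !in_setI => /andP[/andP[ep _] /andP[eq _]].
  case/eqP: pq; apply: half_eq; first by rewrite pv.
  have pT : ht p \in T v by rewrite -pv htP.
  have qT : ht q \in T v by rewrite -qv htP.
  exact: transition_inj pT qT ep eq.
split; first by rewrite /closed_trail cw old_uniq.
  move=> v; have [|p] := hit (e := inr v); first by rewrite mem_split_matching.
  rewrite ends_r => /eqP pv pc; have := old_degree p; rewrite pc => deg.
  have /card_gt0P[e] : 0 < #|ht p :&: K| by case: (_ \in Fc) deg => /=; lia.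
  rewrite in_setI => /andP[ep eK]; apply: (closed_walk_verts cw (e := e)).
    by rewrite mem_old_edges.
  by rewrite -pv; apply: transition_sub (htP p) ep.
move=> v; have [p [q [E pv qv k2]]] := kdeg v.
have -> : [set e in edges_at v | e \in walk_edges s] = edges_at v :&: K.
  by apply/setP=> e; rewrite in_setI [LHS]in_set mem_old_edges.
have := old_degree p; have := old_degree q; rewrite pv qv k2.
have : (p \in walk_verts c) || (q \in walk_verts c).
  have [|r] := hit (e := inr v); first by rewrite mem_split_matching.
  by rewrite E !inE => /orP[]/eqP-> ->; rewrite ?orbT.
have foll r : hv r = v -> r \in walk_verts c -> (inr v : edge G) \notin Fc ->
    follows s (ht r) by move=> <-; apply: old_follows.
case: (boolP (inr v \in Fc)) => vF.
  by case: (p \in _); case: (q \in _) => //= _; left; lia.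
have [pc|pc] := boolP (p \in _); have [qc|qc] := boolP (q \in _) => //= _ ? ?;
  try by left; lia.
right=> P PT; pose r : vert G := exist _ (v, P) PT.
have : r \in ends (inr v : edge G) by rewrite ends_r.
by rewrite E !inE => /orP[]/eqP Er; rewrite -[P]/(ht r) Er; apply: foll.
Qed.

End FromCycle.

End FourConnected.

Lemma nwc_of_dcc :
  (forall G : mgraph, regular G 3 -> cyclically_edge_connected G 4 ->
     exists s : seq (vert G * edge G), dominating_cycle s) ->
  forall H : mgraph, regular H 4 -> k_connected H 4 ->
    forall T : vert H -> {set {set edge H}}, transition_system T -> T_hamiltonian T.
Proof.
move=> dcc H reg4 con4 T hT.
have /card_gt0P[v _] : 0 < #|vert H| by case: con4; case: #|vert H|.
have [p _] : exists p : vert (split_graph reg4 hT), p \in ends (inr v : edge (split_graph reg4 hT)).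
  by have [p [q [_ ->]]] := endsE (inr v : edge (split_graph reg4 hT)); exists p; rewrite !inE eqxx.
have [c [cc hit]] := matching_cycle dcc (@split_cubic _ reg4 _ hT)
  (@matching_degree _ reg4 _ hT) p (@split_small_cuts _ reg4 con4 _ hT).
exact: trail_of_cycle cc hit.
Qed.

Theorem theorem1p2 :
  (forall G : mgraph,
      regular G 3 -> cyclically_edge_connected G 4 ->
      exists s : seq (vert G * edge G), dominating_cycle s)
  <->
  (forall H : mgraph,
      regular H 4 -> k_connected H 4 ->
      forall T : vert H -> {set {set edge H}},
        transition_system T -> T_hamiltonian T).
Proof. by split; [apply: nwc_of_dcc|apply: dcc_of_nwc]. Qed.
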